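(* Let $m\ge 1$, $1\le p<\infty$, and let $U\subset F_B(\mathbb{R}^m)^p$. Then $U$ is a relatively compact set in $(F_B(\mathbb{R}^m)^p, d_p)$ if and only if (i) $U$ is uniformly $p$-mean bounded; and (ii) $U$ is $p$-mean equi-left-continuous.
   Context: $H$ is the Hausdorff metric on nonempty closed subsets of $\mathbb{R}^m$ (Euclidean distance): $H(A,B)=\max\{\sup_{a\in A}\inf_{b\in B}d(a,b),\ \sup_{b\in B}\inf_{a\in A}d(a,b)\}$ (possibly $+\infty$). A fuzzy set on $\mathbb{R}^m$ is a function $u:\mathbb{R}^m\to[0,1]$; its cuts are $[u]_\alpha=\{x: u(x)\ge\alpha\}$ for $\alpha\in(0,1]$ and $[u]_0=\overline{\{x: u(x)>0\}}$. $F_B(\mathbb{R}^m)^p$ is the set of fuzzy sets $u$ on $\mathbb{R}^m$ that are normal ($u(x_0)=1$ for some $x_0$), upper semi-continuous, and satisfy $\left(\int_0^1 H([u]_\alpha,\{0\})^p\,d\alpha\right)^{1/p}<+\infty$, where $0$ is the origin. The metric is $d_p(u,v)=\left(\int_0^1 H([u]_\alpha,[v]_\alpha)^p\,d\alpha\right)^{1/p}$. A set $U\subset F_B(\mathbb{R}^m)^p$ is uniformly $p$-mean bounded if there is $M>0$ with $d_p(u,\widehat{0})\le M$ for all $u\in U$, where $\widehat 0$ is the characteristic function of $\{0\}$. $U$ is $p$-mean equi-left-continuous if for every $\varepsilon>0$ there is $\delta>0$ such that for all $0\le h<\delta$ and all $u\in U$, $\left(\int_h^1 H([u]_\alpha,[u]_{\alpha-h})^p\,d\alpha\right)^{1/p}<\varepsilon$.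 A subset of a metric space $X$ is relatively compact in $X$ if its closure in $X$ is compact. *)

(* Defs.v *)
From HB Require Import structures.
From mathcomp Require Import all_boot all_order all_algebra.
From mathcomp Require Import all_classical all_reals all_analysis.
Set Implicit Arguments.
Unset Strict Implicit.
Unset Printing Implicit Defensive.
Import Order.TTheory GRing.Theory Num.Theory.
Import numFieldNormedType.Exports.
Local Open Scope classical_set_scope.
Local Open Scope ring_scope.

(* The library norm on 'rV[R]_m is the sup norm: it has the Euclidean topology
   (so [closure] below is the usual one) but not the Euclidean distance. *)
Definition euclid_dist (R : realType) (m : nat) (x y : 'rV[R]_m) : R :=
  Num.sqrt (\sum_(i < m) (x ord0 i - y ord0 i) ^+ 2).

Definition hausdorff_excess (R : realType) (m : nat) (A B : set 'rV[R]_m)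
    : \bar R :=
  ereal_sup [set ereal_inf [set (euclid_dist a b)%:E | b in B] | a in A].

Definition hausdorff_dist (R : realType) (m : nat) (A B : set 'rV[R]_m)
    : \bar R :=
  maxe (hausdorff_excess A B) (hausdorff_excess B A).

(* Only used for 0 <= alpha <= 1. *)
Definition alpha_cut (R : realType) (m : nat) (u : 'rV[R]_m -> R) (alpha : R)
    : set 'rV[R]_m :=
  if 0 < alpha then [set x | alpha <= u x] else closure [set x | 0 < u x].

Definition upper_semicontinuous (R : realType) (T : topologicalType)
    (u : T -> R) : Prop :=
  forall x a, u x < a -> \forall y \near x, u y < a.

Definition origin_mean (R : realType) (m : nat) (p : R) (u : 'rV[R]_m -> R)
    : \bar R :=
  ((\int[lebesgue_measure]_(alpha in `[0%R, 1%R])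
      hausdorff_dist (alpha_cut u alpha) [set 0%R] `^ p) `^ p^-1)%E.

Definition dp (R : realType) (m : nat) (p : R) (u v : 'rV[R]_m -> R) : \bar R :=
  ((\int[lebesgue_measure]_(alpha in `[0%R, 1%R])
      hausdorff_dist (alpha_cut u alpha) (alpha_cut v alpha) `^ p) `^ p^-1)%E.

Record FB (R : realType) (m : nat) (p : R) : Type := MkFB {
  FB_fun :> 'rV[R]_m -> R ;
  FB_itv : forall x, 0 <= FB_fun x <= 1 ;
  FB_normal : exists x0, FB_fun x0 = 1 ;
  FB_usc : upper_semicontinuous FB_fun ;
  FB_pmean : (origin_mean p FB_fun < +oo)%E
}.

Definition fuzzy0 (R : realType) (m : nat) : 'rV[R]_m -> R := \1_[set 0].

Section FB_topology.
Context (R : realType) (m : nat) (p : R).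

HB.instance Definition _ := gen_eqMixin (FB m p).
HB.instance Definition _ := gen_choiceMixin (FB m p).

Definition dp_open (O : set (FB m p)) : Prop :=
  forall u, O u ->
    exists2 e : R, 0 < e & forall v : FB m p, (dp p u v < e%:E)%E -> O v.

Let dp_openT : dp_open setT.
Proof. by move=> u _; exists 1. Qed.

Let dp_openI : setI_closed dp_open.
Proof.
move=> A B oA oB u [/oA[e e0 eA] /oB[d d0 dB]].
exists (Num.min e d); first by rewrite lt_min e0.
by move=> v; rewrite EFin_min lt_min => /andP[/eA ? /dB].
Qed.

Let dp_open_bigU (I : Type) (f : I -> set (FB m p)) :
  (forall i, dp_open (f i)) -> dp_open (\bigcup_i f i).
Proof.
move=> of_ u [i _ /of_[e e0 ef]].
by exists e => // v /ef ?; exists i.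
Qed.

(* FB m p carries the topology of the metric dp p. *)
HB.instance Definition _ :=
  isOpenTopological.Build (FB m p) dp_openT dp_openI dp_open_bigU.

End FB_topology.

Definition relatively_compact (T : topologicalType) (U : set T) : Prop :=
  compact (closure U).

Definition uniformly_pmean_bounded (R : realType) (m : nat) (p : R)
    (U : set (FB m p)) : Prop :=
  exists2 M : R, 0 < M &
    forall u, U u -> (dp p u (@fuzzy0 R m) <= M%:E)%E.

(* For h > 1 the domain `[h, 1] is empty, so the condition only bears on
   h <= 1. *)
Definition pmean_equi_left_continuous (R : realType) (m : nat) (p : R)
    (U : set (FB m p)) : Prop :=
  forall eps : R, 0 < eps ->
    exists2 delta : R, 0 < delta &
      forall (h : R) (u : FB m p), 0 <= h < delta -> U u ->
        ((\int[lebesgue_measure]_(alpha in `[h, 1%R])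
            hausdorff_dist (alpha_cut u alpha) (alpha_cut u (alpha - h)%R) `^ p) `^ p^-1
         < eps%:E)%E.

(* Main.v *)
(* A fuzzy set u is recorded by its suprema sup_B u over the countably many
   rational balls B. If v_n is a sequence for which all these suprema converge,
   sup_B v_n -> s_B, let u(x) be the infimum of s_B over the balls B containing
   x. A covering argument shows that the a-cuts of v_n converge in the Hausdorff
   metric to the a-cut of u for every a in ]0, 1] which is not one of the s_B,
   hence for almost every a. This a.e. convergence improves to convergence in
   d_p as soon as the functions a |-> H([v_n]_a, {0}) are bounded at each a > 0,
   which follows from (i), and have uniformly small L^p norm near a = 0, which
   follows from (i) and (ii) by comparing [v]_a with [v]_(a + h). Applied along
   an ultrafilter on the closure of U, this gives sufficiency.
   Conversely (i) and (ii) propagate from points to d_p-neighbourhoods, and so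
   to compact sets; that a single u satisfies (ii) is again a.e. convergence of
   the cuts together with smallness of the L^p norm near 0. *)
Require Import Defs.
From mathcomp Require Import all_boot all_order all_algebra.
From mathcomp Require Import all_classical all_reals all_analysis.
From HB Require Import structures.
From mathcomp Require Import measurable_realfun ring lra.
Set Implicit Arguments.
Unset Strict Implicit.
Unset Printing Implicit Defensive.
Import Order.TTheory GRing.Theory Num.Theory.
Import numFieldNormedType.Exports.
Local Open Scope classical_set_scope.
Local Open Scope ring_scope.

(** * Euclidean and Hausdorff distances *)

Section euclidean_distance.
Context (R : realType) (m : nat).
Implicit Types x y z : 'rV[R]_m.

(** Lagrange's identity: the double sum of the squares [(a i * b j - a j * b i) ^+ 2] is twice the
    difference of the two sides. *)
Lemma cauchy_schwarz_sum (a b : 'I_m -> R) :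
  (\sum_i a i * b i) ^+ 2 <= (\sum_i a i ^+ 2) * (\sum_i b i ^+ 2).
Proof.
have : 0 <= \sum_i \sum_j (a i * b j - a j * b i) ^+ 2.
  by apply: sumr_ge0 => i _; apply: sumr_ge0 => j _; exact: sqr_ge0.
have -> : \sum_i \sum_j (a i * b j - a j * b i) ^+ 2 =
    (\sum_i a i ^+ 2) * (\sum_i b i ^+ 2) *+ 2 - (\sum_i a i * b i) ^+ 2 *+ 2.
  transitivity (\sum_i \sum_j (a i ^+ 2 * b j ^+ 2) +
      \sum_i \sum_j (a j ^+ 2 * b i ^+ 2) -
      (\sum_i \sum_j ((a i * b i) * (a j * b j))) *+ 2).
    rewrite -big_split/= -sumrMnl -sumrB; apply: eq_bigr => i _.
    rewrite -big_split/= -sumrMnl -sumrB; apply: eq_bigr => j _.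
    by ring.
  rewrite [X in _ + X - _]exchange_big/= -mulr2n expr2.
  by rewrite !big_distrlr.
by lra.
Qed.

Lemma euclid_dist_ge0 x y : 0 <= euclid_dist x y.
Proof. exact: sqrtr_ge0. Qed.

Lemma euclid_distxx x : euclid_dist x x = 0.
Proof.
rewrite /euclid_dist big1 ?sqrtr0// => i _.
by rewrite subrr expr0n.
Qed.

Lemma euclid_distC x y : euclid_dist x y = euclid_dist y x.
Proof.
congr Num.sqrt; apply: eq_bigr => i _.
by rewrite -sqrrN opprB.
Qed.

Lemma euclid_dist_triangle y x z :
  euclid_dist x z <= euclid_dist x y + euclid_dist y z.
Proof.
rewrite -(@ler_pXn2r _ 2)// ?nnegrE ?addr_ge0 ?euclid_dist_ge0//.
have S0 (f : 'I_m -> R) : 0 <= \sum_i f i ^+ 2.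
  by apply: sumr_ge0 => i _; exact: sqr_ge0.
rewrite sqrrD /euclid_dist !sqr_sqrtr ?S0//.
set a := fun i => x ord0 i - y ord0 i; set b := fun i => y ord0 i - z ord0 i.
have -> : \sum_(i < m) (x ord0 i - z ord0 i) ^+ 2 =
    \sum_i a i ^+ 2 + (\sum_i a i * b i) *+ 2 + \sum_i b i ^+ 2.
  rewrite -sumrMnl -!big_split/=; apply: eq_bigr => i _.
  by rewrite /a /b; ring.
rewrite lerD2r lerD2l lerMn2r//= -sqrtrM ?S0//.
apply: (le_trans (ler_norm _)); rewrite -sqrtr_sqr ler_sqrt.
  exact: cauchy_schwarz_sum.
by rewrite mulr_ge0 ?S0.
Qed.

(** Together with [norm_coord_le_euclid], this compares the Euclidean distance with the sup norm, so
    that topological facts about the latter apply to the former. The crude factor [m] in place of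
    its square root is enough for that. *)
Lemma euclid_dist_le_sup x y (e : R) :
  (forall i, `|x ord0 i - y ord0 i| <= e) -> 0 <= e -> euclid_dist x y <= m%:R * e.
Proof.
move=> xye e0; rewrite -(@ler_pXn2r _ 2)// ?nnegrE ?mulr_ge0 ?euclid_dist_ge0//.
rewrite sqr_sqrtr; last by apply: sumr_ge0 => i _; exact: sqr_ge0.
apply: (@le_trans _ _ (\sum_(i < m) e ^+ 2)).
  apply: ler_sum => i _; rewrite -real_normK ?num_real//.
  by rewrite ler_pXn2r// nnegrE.
rewrite sumr_const card_ord -[leLHS]mulr_natl exprMn ler_wpM2r ?sqr_ge0//.
by rewrite -natrX ler_nat; case: (m) => // k; rewrite expnS expn1 leq_pmulr.
Qed.

Lemma norm_coord_le_euclid x y i : `|x ord0 i - y ord0 i| <= euclid_dist x y.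
Proof.
rewrite -sqrtr_sqr ler_sqrt; last by apply: sumr_ge0 => j _; exact: sqr_ge0.
rewrite (bigD1 i)//= lerDl; apply: sumr_ge0 => j _; exact: sqr_ge0.
Qed.

Lemma near_euclid_dist x (e : R) : 0 < e -> \forall y \near x, euclid_dist x y < e.
Proof.
(* Dividing by [m.+1] gives [m%:R * r < e] strictly, and is meaningful for every [m]. *)
move=> e0; pose r := e / m.+1%:R.
have r0 : 0 < r by rewrite divr_gt0.
apply/nbhs_ballP; exists r => //= y [_ xy].
apply: (@le_lt_trans _ _ (m%:R * r)).
  by apply: euclid_dist_le_sup; [move=> i; apply: ltW; exact: xy|exact: ltW].
by rewrite /r mulrCA gtr_pMr// ltr_pdivrMr// mul1r ltr_nat.
Qed.

Lemma closed_euclid_ball x (e : R) : closed [set y | euclid_dist x y <= e].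
Proof.
move=> y ycl; rewrite /= leNgt; apply/negP => xye.
have e0 : 0 < euclid_dist x y - e by rewrite subr_gt0.
have [z [/= xz yz]] := ycl _ (near_euclid_dist y e0).
have := euclid_dist_triangle z x y; rewrite (euclid_distC z y); lra.
Qed.

Lemma bounded_euclid (A : set 'rV[R]_m) (r : R) :
  (forall x, A x -> euclid_dist x 0 <= r) -> bounded_set A.
Proof.
move=> Ar; exists `|r|; split; first exact: num_real.
move=> M rM x /Ar xr /=.
have M0 : 0 <= M by apply: ltW; apply: le_lt_trans rM.
rewrite [leLHS]mx_normrE; apply: bigmax_le => //= -[i j] _ /=.
rewrite (ord1 i) -[x ord0 j]subr0.
have := norm_coord_le_euclid x 0 j; rewrite mxE.
move=> /le_trans -> //; apply: (le_trans xr); apply: (le_trans (ler_norm _)).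
exact: ltW.
Qed.

Lemma compact_euclid (A : set 'rV[R]_m) (r : R) :
  (forall x, A x -> euclid_dist x 0 <= r) -> closed A -> compact A.
Proof. by move=> /bounded_euclid; exact: bounded_closed_compact. Qed.

End euclidean_distance.

(** * A countable base of rational balls *)

Section countable_base.
Context (R : realType) (m : nat).

(** These are balls of the sup norm, that is, cubes. The index type is countable, which later serves
    both for countable unions and for enumeration by [pickle]; the shift [i.2.+1] keeps the radius
    positive and finite. *)
Definition rat_ball (i : 'rV[rat]_m * nat) : set 'rV[R]_m :=
  ball (map_mx ratr i.1 : 'rV[R]_m) (i.2.+1%:R^-1).

Lemma open_rat_ball i : open (rat_ball i).
Proof. exact: ball_open. Qed.

Lemma rat_ball_center i : rat_ball i (map_mx ratr i.1).
Proof. by apply: ballxx; rewrite invr_gt0. Qed.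

Lemma rat_ball_base (x : 'rV[R]_m) (A : set 'rV[R]_m) : nbhs x A ->
  exists2 i, rat_ball i x & rat_ball i `<=` A.
Proof.
move=> /nbhs_ballP[e /= e0 xA].
(* Two points of a ball of radius 1/(n+1) are less than 2/(n+1) apart, so this radius keeps any such
   ball containing [x] inside the ball of radius [e] about [x]. *)
have [n ne] : exists n : nat, n.+1%:R^-1 < e / 2.
  have /= e20 : 0 < e / 2 by rewrite divr_gt0.
  have [n _ /(_ n (leqnn _))] := near_infty_natSinv_lt (PosNum e20).
  by exists n.
have n0 : (0:R) < n.+1%:R^-1 by rewrite invr_gt0.
set d := n.+1%:R^-1 in ne n0.
have /choice[c cP] : forall j : 'I_m, exists q : rat, `|x ord0 j - ratr q| < d.
  move=> j; have [q] := @rat_in_itvoo R (x ord0 j - d) (x ord0 j + d) ltac:(lra).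
  by rewrite in_itv/= => /andP[? ?]; exists q; rewrite ltr_norml; apply/andP; split; lra.
exists (\row_j c j, n).
  by split=> // i j; rewrite (ord1 i) !mxE; rewrite /ball/= distrC; exact: cP.
move=> y [_ xy]; apply: xA; split=> // i j; have := xy i j.
rewrite (ord1 i) !mxE /ball/= -/d => qy.
have xq := cP j.
apply: (@le_lt_trans _ _ (`|x ord0 j - ratr (c j)| + `|ratr (c j) - y ord0 j|)).
  exact: ler_distD.
by apply: (lt_trans (ltrD xq qy)); lra.
Qed.

End countable_base.

(** * Hausdorff excess and distance, and their measurability along decreasing families *)

Section hausdorff.
Context (R : realType) (m : nat).
Implicit Types A B C : set 'rV[R]_m.
Local Open Scope ereal_scope.

Let dist_inf_ge0 (a : 'rV[R]_m) B :
  0 <= ereal_inf [set (euclid_dist a b)%:E | b in B].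
Proof. by apply: le_ereal_inf_tmp => _ [b _ <-]; rewrite lee_fin euclid_dist_ge0. Qed.

Lemma excess_ge0 A B : A !=set0 -> 0 <= hausdorff_excess A B.
Proof.
move=> [a Aa]; apply: (@le_trans _ _ (ereal_inf [set (euclid_dist a b)%:E | b in B])).
  exact: dist_inf_ge0.
by apply: ereal_sup_ubound; exists a.
Qed.

Lemma excess_le A B (e : R) :
  (forall a, A a -> exists2 b, B b & (euclid_dist a b <= e)%R) ->
  hausdorff_excess A B <= e%:E.
Proof.
move=> AB; apply: ge_ereal_sup => _ [a /AB[b Bb abe] <-].
by apply: ge_ereal_inf; exists (euclid_dist a b)%:E; [exists b|rewrite lee_fin].
Qed.

Lemma excess_triangle B A C : A !=set0 -> B !=set0 ->
  hausdorff_excess A C <= hausdorff_excess A B + hausdorff_excess B C.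
Proof.
move=> A0 B0.
have := excess_ge0 B A0; have := excess_ge0 C B0.
have AB a : A a -> ereal_inf [set (euclid_dist a b)%:E | b in B] <= hausdorff_excess A B.
  by move=> Aa; apply: ereal_sup_ubound; exists a.
have BC b : B b -> ereal_inf [set (euclid_dist b c)%:E | c in C] <= hausdorff_excess B C.
  by move=> Bb; apply: ereal_sup_ubound; exists b.
move: AB BC.
case: (hausdorff_excess A B) => [r1| |]//; case: (hausdorff_excess B C) => [r2| |]//;
  rewrite ?[X in _ <= X]/= ?leey// => AB BC _ _.
 apply: ge_ereal_sup => _ [a /AB Aa <-].
(* Both excesses are now finite. The infima over [B] and [C] need not be attained, so each is
   approached within [e / 2]. *)
apply/lee_addgt0Pr => e e0.
have er1 : r1%:E < (r1 + e / 2)%:E by rewrite lte_fin ltrDl divr_gt0.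
have /ereal_inf_lt[_ [b /BC Bb <-]] := le_lt_trans Aa er1.
rewrite lte_fin => ab.
have er2 : r2%:E < (r2 + e / 2)%:E by rewrite lte_fin ltrDl divr_gt0.
have /ereal_inf_lt[_ [c Cc <-]] := le_lt_trans Bb er2.
rewrite lte_fin => bc.
apply: ge_ereal_inf; exists (euclid_dist a c)%:E; first by exists c.
rewrite -!EFinD lee_fin; have := euclid_dist_triangle b a c; lra.
Qed.

Lemma hausdorff_distC A B : hausdorff_dist A B = hausdorff_dist B A.
Proof. exact: maxC. Qed.

Lemma hausdorff_dist_ge0 A B : A !=set0 -> 0 <= hausdorff_dist A B.
Proof. by move=> A0; rewrite le_max excess_ge0. Qed.

Lemma hausdorff_dist_le A B (e : R) :
  (forall a, A a -> exists2 b, B b & (euclid_dist a b <= e)%R) ->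
  (forall b, B b -> exists2 a, A a & (euclid_dist b a <= e)%R) ->
  hausdorff_dist A B <= e%:E.
Proof. by move=> AB BA; rewrite ge_max !excess_le. Qed.

Lemma hausdorff_distxx A : A !=set0 -> hausdorff_dist A A = 0.
Proof.
move=> A0; apply/eqP; rewrite eq_le hausdorff_dist_ge0// andbT.
by apply: hausdorff_dist_le => a Aa; exists a; rewrite ?euclid_distxx.
Qed.

Lemma hausdorff_dist_triangle B A C : A !=set0 -> B !=set0 -> C !=set0 ->
  hausdorff_dist A C <= hausdorff_dist A B + hausdorff_dist B C.
Proof.
move=> A0 B0 C0; rewrite ge_max; apply/andP; split.
  by apply: (le_trans (excess_triangle C A0 B0)); apply: leeD; rewrite le_max lexx.
apply: (le_trans (excess_triangle A C0 B0)); rewrite addeC.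
by apply: leeD; rewrite le_max lexx orbT.
Qed.

(** The excess of {0} over [A] is the infimum of the numbers |a|, the excess of [A] over {0} their
    supremum; since [A] is nonempty the latter is the larger. *)
Lemma hausdorff_dist0E A : A !=set0 ->
  hausdorff_dist A [set 0%R] = hausdorff_excess A [set 0%R].
Proof.
move=> [a Aa]; apply/max_idPl; apply: ge_ereal_sup => _ [_ -> <-].
apply: (@le_trans _ _ (euclid_dist a 0)%:E).
  by apply: ereal_inf_lbound; exists a => //; rewrite euclid_distC.
apply: (@le_trans _ _ (ereal_inf [set (euclid_dist a b)%:E | b in [set 0%R]])).
  by apply: le_ereal_inf_tmp => _ [_ -> <-].
by apply: ereal_sup_ubound; exists a.
Qed.

Lemma hausdorff_dist0_leP A (r : R) : A !=set0 ->
  hausdorff_dist A [set 0%R] <= r%:E <-> forall a, A a -> (euclid_dist a 0 <= r)%R.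
Proof.
move=> A0; rewrite hausdorff_dist0E//; split => [Ar a Aa|Ar]; last first.
  by apply: excess_le => a Aa; exists 0%R => //; exact: Ar.
rewrite -lee_fin; apply: le_trans Ar.
apply: (@le_trans _ _ (ereal_inf [set (euclid_dist a b)%:E | b in [set 0%R]])).
  by apply: le_ereal_inf_tmp => _ [_ -> <-].
by apply: ereal_sup_ubound; exists a.
Qed.

Lemma le_hausdorff_dist0 A B : A !=set0 -> A `<=` B ->
  hausdorff_dist A [set 0%R] <= hausdorff_dist B [set 0%R].
Proof.
move=> A0 AB; rewrite !hausdorff_dist0E//; last by case: A0 => a /AB; exists a.
by apply: le_ereal_sup => _ [a Aa <-]; exists a => //; exact: AB.
Qed.

(** This prepares measurability: the inequality is expressed by countable data in which [A] and [B]
    are decoupled, [A] having to meet a rational ball and [B] to stay away from it. *)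
Lemma excess_gtP A B (r : R) : r%:E < hausdorff_excess A B <->
  exists (i : 'rV[rat]_m * nat) (n : nat), (A `&` rat_ball i !=set0) /\
    forall a b, rat_ball i a -> B b -> (r + n.+1%:R^-1 <= euclid_dist a b)%R.
Proof.
split=> [/ereal_sup_gt[_ [a Aa <-]] rab|[i [n [[a [Aa ia]] aB]]]]; last first.
  apply: (@lt_le_trans _ _ (r + n.+1%:R^-1)%:E); first by rewrite lte_fin ltrDl invr_gt0.
  apply: (@le_trans _ _ (ereal_inf [set (euclid_dist a b)%:E | b in B])).
    by apply: le_ereal_inf_tmp => _ [b Bb <-]; rewrite lee_fin; exact: aB.
  by apply: ereal_sup_ubound; exists a.
have [s rs sB] : exists2 s : R, (r < s)%R & forall b, B b -> (s <= euclid_dist a b)%R.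
  have aB b : B b -> ereal_inf [set (euclid_dist a b)%:E | b in B] <= (euclid_dist a b)%:E.
    by move=> Bb; apply: ereal_inf_lbound; exists b.
  move: rab aB; case: (ereal_inf _) => [s| |]//=.
    by rewrite lte_fin => rs aB; exists s => // b /aB; rewrite lee_fin.
  by move=> _ aB; exists (r + 1)%R; rewrite ?ltrDl// => b /aB; rewrite leye_eq.
(* The gap [s - r] is shared: one half bounds the distance from [a] to the points of the ball, the
   other half is the margin 1/(n+1). *)
have e0 : (0 < (s - r) / 2)%R by rewrite divr_gt0 // subr_gt0.
have [n _ /(_ n (leqnn _))/= ne] := near_infty_natSinv_lt (PosNum e0).
have [i ia iA] := rat_ball_base (near_euclid_dist a e0).
exists i, n; split; first by exists a.
move=> a' b /iA /= aa' /sB sb.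
have := euclid_dist_triangle a' a b; move: ne; set d := (n.+1%:R^-1)%R; lra.
Qed.

(** For a decreasing family, the levels at which [S] is hit form a down-set, hence an interval. *)
Lemma measurable_antitone_hit (A : R -> set 'rV[R]_m) (S : set 'rV[R]_m) :
  (forall a b, (a <= b)%R -> A b `<=` A a) ->
  measurable [set a | A a `&` S !=set0].
Proof.
move=> Aanti; apply: is_interval_measurable => a b _ [x [Ax Sx]] z.
by move=> /andP[az zb]; exists x; split => //; exact: Aanti Ax.
Qed.

(** By [excess_gtP] each strict superlevel set is a countable union of intersections of an interval
    ([A a] meets the ball) with the complement of an interval ([B a] meets a neighbourhood of the
    ball). *)
Lemma measurable_excess (A B : R -> set 'rV[R]_m) :
  (forall a b, (a <= b)%R -> A b `<=` A a) ->
  (forall a b, (a <= b)%R -> B b `<=` B a) ->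
  measurable_fun setT (fun a => hausdorff_excess (A a) (B a)).
Proof.
move=> Aanti Banti; apply: (measurability _ (ErealGenOInfty.measurableE R)).
move=> _ [_ [r ->] <-]; rewrite setTI.
have -> : (fun a => hausdorff_excess (A a) (B a)) @^-1` `]r%:E, +oo[%classic =
    \bigcup_(j : ('rV[rat]_m * nat) * nat)
      ([set a | A a `&` rat_ball j.1 !=set0] `&`
       ~` [set a | B a `&` [set b | exists2 x, rat_ball j.1 x &
                       (euclid_dist x b < r + j.2.+1%:R^-1)%R] !=set0]).
  apply/seteqP; split => a /=.
    rewrite in_itv/= andbT => /excess_gtP[i [n [iA iB]]].
    exists (i, n) => //; split => //= -[b [Bb [x ix]]]; apply/negP.
    by rewrite -leNgt; exact: iB.
  move=> [[i n] _ [/= iA iB]]; rewrite in_itv/= andbT; apply/excess_gtP.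
  exists i, n; split => // x b ix Bb; rewrite leNgt; apply/negP => xb.
  by apply: iB; exists b; split => //; exists x.
apply: countable_bigcupT_measurable => // j; apply: measurableI.
  exact: measurable_antitone_hit.
by apply: measurableC; exact: measurable_antitone_hit.
Qed.

Lemma measurable_hausdorff_dist (A B : R -> set 'rV[R]_m) :
  (forall a b, (a <= b)%R -> A b `<=` A a) ->
  (forall a b, (a <= b)%R -> B b `<=` B a) ->
  measurable_fun setT (fun a => hausdorff_dist (A a) (B a)).
Proof. by move=> *; apply: measurable_maxe; exact: measurable_excess. Qed.

End hausdorff.

(** * Cuts of fuzzy sets *)

Section cuts.
Context (R : realType) (m : nat).

Lemma alpha_cut_gt0 (f : 'rV[R]_m -> R) a : 0 < a -> alpha_cut f a = [set x | a <= f x].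
Proof. by rewrite /alpha_cut => ->. Qed.

(** This holds on the whole line because every level [<= 0] yields the closed support; hence
    measurability can be stated on [setT] and shifted levels [a - h] cause no trouble. *)
Lemma alpha_cut_antitone (f : 'rV[R]_m -> R) a b : a <= b -> alpha_cut f b `<=` alpha_cut f a.
Proof.
move=> ab; rewrite /alpha_cut; case: ifPn => b0; case: ifPn => a0 x //=.
- exact: le_trans.
- by move=> bx; apply: subset_closure => /=; apply: lt_le_trans bx.
- by have := lt_le_trans a0 ab; rewrite (negbTE b0).
Qed.

Lemma alpha_cut_fuzzy0 a : a <= 1 -> alpha_cut (@fuzzy0 R m) a = [set 0].
Proof.
move=> a1.
have e b : 0 <= b -> b < 1 -> [set x | b < @fuzzy0 R m x] = [set 0].
  move=> b0 b1; apply/seteqP; split => x /=; rewrite /fuzzy0 indicE.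
    by case: (boolP (x \in [set 0])) => [/set_mem//|_]; rewrite ltNge b0.
  by move=> ->; rewrite mem_set.
rewrite /alpha_cut; case: ifPn => a0; last first.
  rewrite e//; apply/esym/closure_id.
  by apply: accessible_closed_set1; exact: (hausdorff_accessible (@norm_hausdorff _ _)).
apply/seteqP; split => x /=; rewrite /fuzzy0 indicE.
  case: (boolP (x \in [set 0])) => [/set_mem//|_].
  by rewrite leNgt a0.
by move=> ->; rewrite mem_set.
Qed.

End cuts.

(** * The L^p seminorm on subsets of the line *)

Section lp_seminorm.
Context (R : realType) (p : R).
Hypothesis p1 : 1 <= p.
Local Open Scope ereal_scope.
Local Notation mu := (@lebesgue_measure R).
Implicit Types (D : set R) (f g h : R -> \bar R).

Definition lp D f : \bar R := (\int[mu]_(x in D) f x `^ p) `^ p^-1.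

Let p0 : (0 < p)%R. Proof. exact: lt_le_trans p1. Qed.
Let pV0 : (0 < p^-1)%R. Proof. by rewrite invr_gt0. Qed.
Let pn0 : p != 0%R. Proof. by rewrite gt_eqF. Qed.

#[local] Instance ae_lebesgue_filter : Filter (nbhs (almost_everywhere mu)).
Proof. exact: ae_filter_ringOfSetsType. Qed.

Lemma le_poweR (r : R) (x y : \bar R) : (0 <= r)%R -> 0 <= x -> x <= y -> x `^ r <= y `^ r.
Proof.
move=> r0 x0 xy; apply: gt0_ler_poweR => //; rewrite in_itv/= leey andbT//.
exact: le_trans xy.
Qed.

Lemma measurable_pow f : measurable_fun setT f -> measurable_fun setT (fun x => f x `^ p).
Proof. by move=> mf; apply: (measurableT_comp (measurable_poweR p)). Qed.

Let mpow D f : measurable_fun setT f -> measurable_fun D (fun x => f x `^ p).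
Proof. by move=> mf; apply: measurable_funTS; exact: measurable_pow. Qed.

Lemma measurable_fun_restrict d (T : measurableType d) D (f : R -> T) : measurable D ->
  measurable_fun setT f -> measurable_fun setT (f \_ D).
Proof. by move=> mD mf; apply/(measurable_restrictT _ mD); exact: measurable_funTS. Qed.

Let int_pow_ge0 D f : 0 <= \int[mu]_(x in D) f x `^ p.
Proof. by apply: integral_ge0 => x _; exact: poweR_ge0. Qed.

Lemma lp_ge0 D f : 0 <= lp D f.
Proof. exact: poweR_ge0. Qed.

Lemma lp_ae_le D f g : measurable D -> measurable_fun setT f -> measurable_fun setT g ->
  (forall x, D x -> 0 <= f x) -> {ae mu, forall x, D x -> f x <= g x} -> lp D f <= lp D g.
Proof.
move=> mD mf mg f0 fg; apply: le_poweR => //; first exact: ltW.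
apply: ae_ge0_le_integral => //; try (by move=> *; exact: poweR_ge0); try exact: mpow.
apply: filterS fg => x fgx Dx; apply: le_poweR; [exact: ltW|exact: f0|exact: fgx].
Qed.

Lemma lp_le D f g : measurable D -> measurable_fun setT f -> measurable_fun setT g ->
  (forall x, D x -> 0 <= f x <= g x) -> lp D f <= lp D g.
Proof.
move=> mD mf mg fg; apply: lp_ae_le => // [x /fg/andP[]//|].
by apply: aeW => x /fg/andP[].
Qed.

Lemma lp_subset D E f : measurable D -> measurable E -> measurable_fun setT f ->
  D `<=` E -> lp D f <= lp E f.
Proof.
move=> mD mE mf DE; apply: le_poweR => //; first exact: ltW.
apply: ge0_subset_integral => //; first exact: mpow.
by move=> *; exact: poweR_ge0.
Qed.

Lemma eq_lp D f g : (forall x, D x -> f x = g x) -> lp D f = lp D g.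
Proof.
move=> fg; congr (_ `^ _); apply: eq_integral => x /[!inE] Dx.
by rewrite fg.
Qed.

Lemma lp_restrict D E f : lp D (f \_ E) = lp (D `&` E) f.
Proof.
rewrite /lp integral_mkcondr; congr (_ `^ _); apply: eq_integral => x _.
by rewrite /patch; case: ifPn => // _; rewrite poweR0r.
Qed.

Let Lnorm_restrict D (F : R -> R) : (forall x, D x -> (0 <= F x)%R) ->
  Lnorm mu p%:E (EFin \o (F \_ D)) = lp D (EFin \o F).
Proof.
move=> F0; rewrite unlock /lp [in RHS]integral_mkcond; congr (_ `^ _).
apply: eq_integral => x _; rewrite /= /patch; case: ifPn => [/[!inE] Dx|_].
  by rewrite ger0_norm// F0.
by rewrite normr0 powR0.
Qed.

Let fin_ae D f : measurable D -> measurable_fun setT f -> (forall x, D x -> 0 <= f x) ->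
  \int[mu]_(x in D) f x `^ p < +oo -> {ae mu, forall x, D x -> f x \is a fin_num}.
Proof.
move=> mD mf f0 foo.
have : mu.-integrable D (fun x => f x `^ p).
  apply/integrableP; split; first exact: mpow.
  by under eq_integral do rewrite gee0_abs ?poweR_ge0//.
move=> If.
have Ifin : {ae mu, forall x, D x -> f x `^ p \is a fin_num} by apply: (integrable_ae _ If).
apply: filterS Ifin => x fx Dx; have := fx Dx.
have := f0 _ Dx; case: (f x) => //.
by move=> _; rewrite poweRyr.
Qed.

(* The library inequality is for real-valued functions: it is applied to the
   finite parts of [f] and [g], which are a.e. finite when the right-hand side
   is. *)
Lemma lp_minkowski D f g h : measurable D -> measurable_fun setT f ->
  measurable_fun setT g -> measurable_fun setT h ->
  (forall x, D x -> 0 <= f x) -> (forall x, D x -> 0 <= g x) ->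
  (forall x, D x -> 0 <= h x <= f x + g x) -> lp D h <= lp D f + lp D g.
Proof.
move=> mD mf mg mh f0 g0 hfg.
have [If|If] := ltP (\int[mu]_(x in D) f x `^ p) +oo; last first.
  move: If; rewrite leye_eq /lp => /eqP ->; rewrite poweRyr ?invr_eq0// addye ?leey//.
  by rewrite gt_eqF// (lt_le_trans _ (poweR_ge0 _ _)).
have [Ig|Ig] := ltP (\int[mu]_(x in D) g x `^ p) +oo; last first.
  move: Ig; rewrite leye_eq /lp => /eqP ->; rewrite [X in _ + X]poweRyr ?invr_eq0// addey ?leey//.
  by rewrite gt_eqF// (lt_le_trans _ (poweR_ge0 _ _)).
pose F x := fine (f x); pose G x := fine (g x).
have F0 x : D x -> (0 <= F x)%R by move=> Dx; rewrite fine_ge0// f0.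
have G0 x : D x -> (0 <= G x)%R by move=> Dx; rewrite fine_ge0// g0.
have mF : measurable_fun setT F by apply: (measurableT_comp (fine_measurable measurableT)).
have mG : measurable_fun setT G by apply: (measurableT_comp (fine_measurable measurableT)).
apply: (@le_trans _ _ (lp D (EFin \o (F \+ G)%R))).
  apply: lp_ae_le => //.
  - by apply/measurable_EFinP; exact: measurable_funD.
  - by move=> x /hfg/andP[].
  - have := fin_ae mD mg g0 Ig; have := fin_ae mD mf f0 If.
    apply: filterS2 => x fx gx Dx; have /andP[_] := hfg _ Dx.
    by rewrite /= EFinD /F /G !fineK ?fx ?gx.
have FGE : ((F \+ G) \_ D = (F \_ D) \+ (G \_ D))%R.
  by apply/funext => x; rewrite /= /patch; case: ifPn => // _; rewrite addr0.
rewrite -Lnorm_restrict; last by move=> x Dx; rewrite addr_ge0 ?F0 ?G0.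
rewrite FGE; apply: (le_trans (eminkowski _ _ _ _)).
- exact: measurable_fun_restrict.
- exact: measurable_fun_restrict.
- by rewrite lee_fin.
rewrite !Lnorm_restrict//; apply: leeD; apply: lp_le => //; try exact/measurable_EFinP.
- move=> x Dx; rewrite /= lee_fin F0//= /F; have := f0 _ Dx.
  by case: (f x) => //= *; rewrite leey.
- move=> x Dx; rewrite /= lee_fin G0//= /G; have := g0 _ Dx.
  by case: (g x) => //= *; rewrite leey.
Qed.

(** Minkowski's inequality on the union, applied to the restrictions of [f] to [D] and to [E], whose
    sum dominates [f]. *)
Lemma lp_setU D E f : measurable D -> measurable E -> measurable_fun setT f ->
  (forall x, (D `|` E) x -> 0 <= f x) -> lp (D `|` E) f <= lp D f + lp E f.
Proof.
move=> mD mE mf f0.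
have patchE A : A `<=` D `|` E -> lp A f = lp (D `|` E) (f \_ A).
  by move=> ADE; rewrite lp_restrict setIidr.
rewrite (patchE D)// (patchE E)//.
have mDE : measurable (D `|` E) by exact: measurableU.
have patch0 A x : (D `|` E) x -> 0 <= (f \_ A) x.
  by move=> DEx; rewrite /patch; case: ifPn => // _; exact: f0.
apply: lp_minkowski => //; try exact: patch0; try exact: measurable_fun_restrict.
move=> x DEx; rewrite f0//=; case: (DEx) => Ax; rewrite [in leRHS]/patch (mem_set Ax).
  by rewrite leeDl// patch0.
by rewrite leeDr// patch0.
Qed.

Lemma lp_le_cst D f (K : R) : measurable D -> measurable_fun setT f -> D `<=` `[0%R, 1%R] ->
  (0 <= K)%R -> (forall x, D x -> 0 <= f x <= K%:E) -> lp D f <= K%:E.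
Proof.
move=> mD mf D01 K0 fK.
apply: (le_trans (lp_le (g := cst K%:E) mD mf _ fK)) => //.
rewrite /lp integral_cst// -[leRHS]poweRe1// -(mulfV pn0) poweRrM.
apply: le_poweR; [exact: ltW|by rewrite mule_ge0// lee_fin powR_ge0|].
rewrite -[leRHS]mule1; apply: lee_wpmul2l; first by rewrite lee_fin powR_ge0.
apply: (@le_trans _ _ (mu (`[0%R, 1%R] : set R))).
  by apply: le_measure => //; rewrite inE.
by rewrite lebesgue_measure_itv /= lte_fin ltr01 oppr0 adde0.
Qed.

Lemma lp_cst_itv (K a : R) : (0 <= K)%R -> (0 < a)%R ->
  lp `[0%R, a] (cst K%:E) = (K * a `^ p^-1)%:E.
Proof.
move=> K0 a0; rewrite /lp integral_cst// [X in (_ * X) `^ _](_ : _ = a%:E); last first.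
  by rewrite [LHS]lebesgue_measure_itv/= lte_fin a0 oppr0 adde0.
by rewrite -EFinM poweR_EFin powRM ?powR_ge0 ?(ltW a0)// -powRrM mulfV// powRr1.
Qed.

(** A Chebyshev-type bound. It will be applied to decreasing functions, which are at least [f a] on
    all of [[0, a]]. *)
Lemma le_lp_cst f (K a : R) : measurable_fun setT f -> (0 <= K)%R -> (0 < a <= 1)%R ->
  (forall x, (0 <= x <= a)%R -> K%:E <= f x) ->
  (K * a `^ p^-1)%:E <= lp `[0%R, 1%R] f.
Proof.
move=> mf K0 /andP[a0 a1] Kf; rewrite -lp_cst_itv//.
have ma : measurable (`[0%R, a] : set R) by [].
apply: (@le_trans _ _ (lp `[0%R, a] f)).
  by apply: lp_le => // x; rewrite /= in_itv/= => /Kf ->; rewrite lee_fin K0.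
apply: lp_subset => // x /=; rewrite !in_itv/= => /andP[-> xa].
exact: le_trans a1.
Qed.

(** The pushforward of Lebesgue measure by a translation agrees with it on half-open intervals,
    hence everywhere by uniqueness. *)
Lemma ge0_integral_translate D f (c : R) : measurable D -> measurable_fun setT f ->
  (forall x, D x -> 0 <= f x) ->
  \int[mu]_(x in [set x | D (x - c)%R]) f (x - c)%R = \int[mu]_(x in D) f x.
Proof.
move=> mD mf f0; pose phi (x : measurableTypeR R) : measurableTypeR R := (x - c)%R.
have mphi : measurable_fun setT phi by exact: measurable_funB.
pose phiM := HB.pack_for {mfun (measurableTypeR R) >-> (measurableTypeR R)} phi
  (isMeasurableFun.Build _ _ _ _ phi mphi).
transitivity (\int[pushforward mu phiM]_(x in D) f x).
  apply/esym; apply: (ge0_integral_pushforward mphi) => //.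
    exact: measurable_funTS.
  by move=> x /[!inE]; exact: f0.
apply/esym; apply: (eq_measure_integral (pushforward mu phiM)) => A mA _.
apply: (@lebesgue_measure_unique R (pushforward mu phiM)) => //.
move=> X /ocitvP[->|[[a b]/= ab ->]]; first by rewrite !measure0.
rewrite /pushforward (_ : _ @^-1` _ = `]a + c, b + c]%classic)%R; last first.
  by apply/seteqP; split => x /=; rewrite !in_itv/= ltrBrDr lerBlDr.
rewrite !lebesgue_measure_itv/= !lte_fin ltrD2r ab -!EFinD.
by congr EFin; ring.
Qed.

Lemma lp_translate D f (c : R) : measurable D -> measurable_fun setT f ->
  lp [set x | D (x - c)%R] (fun x => f (x - c)%R) = lp D f.
Proof.
move=> mD mf; congr (_ `^ _).
apply: (ge0_integral_translate (f := fun x => f x `^ p)) => //; first exact: measurable_pow.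
by move=> *; exact: poweR_ge0.
Qed.

Lemma lp_leP D f (e : R) : (0 <= e)%R ->
  lp D f <= e%:E <-> \int[mu]_(x in D) f x `^ p <= (e `^ p)%:E.
Proof.
move=> e0; split => [|ie].
  move=> /(le_poweR (ltW p0) (lp_ge0 _ _)); rewrite /lp -poweRrM mulVf//.
  by rewrite poweRe1// poweR_EFin.
rewrite (_ : e%:E = (e `^ p)%:E `^ p^-1); first by apply: le_poweR => //; exact: ltW.
by rewrite poweR_EFin -powRrM mulfV// powRr1.
Qed.

Lemma countable_ae (C : set R) : countable C -> {ae mu, forall x, ~ C x}.
Proof.
move=> cC; exists C; split.
- by apply: countable_measurable => // t; exact: measurable_set1.
- exact: countable_lebesgue_measure0.
- by move=> x /= /contrapT.
Qed.

(** Dominated convergence off the null set [C], with a constant as dominating function on a set of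
    finite measure. *)
Lemma lp_cvg0_bounded D (f : nat -> R -> \bar R) (C : set R) (K : R) :
  measurable D -> D `<=` `[0%R, 1%R] -> (forall n, measurable_fun setT (f n)) ->
  (forall n x, D x -> 0 <= f n x) -> countable C ->
  (forall x, D x -> ~ C x -> forall e : R, (0 < e)%R -> \forall n \near \oo, f n x <= e%:E) ->
  (\forall n \near \oo, forall x, D x -> f n x <= K%:E) ->
  forall e : R, (0 < e)%R -> \forall n \near \oo, lp D (f n) <= e%:E.
Proof.
move=> mD D01 mf f0 cC fC fK e e0.
pose K' := Num.max K 0%R.
have K'0 : (0 <= K')%R by rewrite le_max lexx orbT.
(* Truncation at [K'] makes the functions real-valued and dominated for every [n], while [g n]
   agrees with [f n] on [D] for all large [n]. *)
pose g n x := fine (mine (f n x) K'%:E).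
have gE n x : D x -> (g n x)%:E = mine (f n x) K'%:E.
  move=> Dx; rewrite /g fineK//; have := f0 n _ Dx.
  case: (f n x) => [r _|_|//]; first by rewrite -EFin_min.
  by rewrite /Order.min ltNge leey.
have g0 n x : D x -> (0 <= g n x)%R.
  by move=> Dx; rewrite -lee_fin gE// le_min f0//= lee_fin.
have gK n x : D x -> (g n x <= K')%R.
  by move=> Dx; rewrite -lee_fin gE// ge_min lexx orbT.
have mg n : measurable_fun setT (EFin \o g n).
  apply/measurable_EFinP; apply: (measurableT_comp (fine_measurable measurableT)).
  by apply: measurable_mine => //; exact: measurable_cst.
have muD : mu D < +oo.
  apply: (@le_lt_trans _ _ (mu (`[0%R, 1%R] : set R))).
    by apply: le_measure => //; rewrite inE.
  by rewrite lebesgue_measure_itv /= lte_fin ltr01 oppr0 adde0 ltry.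
have [] := @dominated_convergence _ _ _ mu D mD
  (fun n x => (g n x)%:E `^ p) (cst 0) (cst (K' `^ p)%:E).
- by move=> n; exact: (@mpow D _ (mg n)).
- exact: measurable_cst.
- have := countable_ae cC; apply: filterS => x Cx Dx; apply: cvg_EFin.
    exact: nearW.
  apply/cvgr0Pnorm_le => d d0.
  have dp0 : (0 < d `^ p^-1)%R by rewrite powR_gt0.
  apply: filterS (fC _ Dx Cx _ dp0) => n fnd /=.
  rewrite ger0_norm ?powR_ge0// -[leRHS]powRr1 ?(ltW d0)// -(mulVf pn0) powRrM.
  apply: ge0_ler_powR; rewrite ?nnegrE ?powR_ge0 ?g0//; first exact: ltW.
  by rewrite -lee_fin gE// ge_min fnd.
- apply/integrableP; split; first exact: measurable_cst.
  rewrite (eq_integral (cst (K' `^ p)%:E)); last first.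
    by move=> x _; rewrite /= ger0_norm ?powR_ge0.
  by rewrite integral_cst// lte_mul_pinfty// lee_fin powR_ge0.
- apply: aeW => x n Dx; rewrite /= lee_fin ger0_norm ?powR_ge0//.
  by apply: ge0_ler_powR; rewrite ?nnegrE ?g0 ?gK//; exact: ltW.
move=> _ _; rewrite integral0 => cvgint.
have ep0 : (0 < e `^ p)%R by rewrite powR_gt0.
have near_int : \forall n \near \oo, \int[mu]_(x in D) (g n x)%:E `^ p < (e `^ p)%:E.
  have ep0E : 0 < (e `^ p)%:E by rewrite lte_fin.
  exact: (cvgint _ (open_ereal_lt' ep0E)).
near=> n.
have intn : \int[mu]_(x in D) (g n x)%:E `^ p < (e `^ p)%:E by near: n.
have fnK : forall x, D x -> f n x <= K%:E by near: n.
rewrite (@eq_lp _ _ (EFin \o g n)); first by apply/lp_leP; [exact: ltW|exact: ltW].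
move=> x Dx; rewrite /= gE// min_l//; apply: (le_trans (fnK _ Dx)).
by rewrite lee_fin le_max lexx.
Unshelve. all: by end_near. Qed.

Lemma lp_near0 f : measurable_fun setT f ->
  lp `[0%R, 1%R] f < +oo -> forall e : R, (0 < e)%R ->
  exists2 a : R, (0 < a <= 1)%R & lp `[0%R, a] f <= e%:E.
Proof.
move=> mf foo e e0; pose D : set R := `[0%R, 1%R]%classic.
have mD : measurable D by rewrite /D.
pose g n := (fun x => f x `^ p) \_ `[0%R, n.+1%:R^-1%R]%classic.
have mg n : measurable_fun setT (g n) by apply: measurable_fun_restrict => //; exact: mpow.
have gf n x : `|g n x| <= f x `^ p.
  by rewrite /g /patch; case: ifPn => _; rewrite ?abse0 ?gee0_abs ?poweR_ge0.
have [] := @dominated_convergence _ _ _ mu D mD g (cst 0) (fun x => f x `^ p).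
- by move=> n; apply: measurable_funTS; exact: mg.
- exact: measurable_cst.
- have := countable_ae (countable1 (0%R : R)); apply: filterS => x x0.
  rewrite /D /= in_itv/= => /andP[xge0 x1]; apply: cvg_near_cst.
  have {xge0 x0}x0 : (0 < x)%R by rewrite lt_neqAle xge0 andbT; apply/eqP => /esym.
  have [N _ HN] := near_infty_natSinv_lt (PosNum x0).
  exists N => // n /HN /= nx; rewrite /g /patch; case: ifPn => //.
  by rewrite inE/= in_itv/= => /andP[_]; rewrite leNgt nx.
- apply/integrableP; split; first exact: mpow.
  under eq_integral do rewrite gee0_abs ?poweR_ge0//.
  by apply: lty_poweRy foo; rewrite invr_eq0.
- by apply: aeW => x n _; exact: gf.
move=> _ _; rewrite integral0 => cvgint.
have ep0E : 0 < (e `^ p)%:E by rewrite lte_fin powR_gt0.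
have [N _ /(_ N (leqnn _)) HN] := cvgint _ (open_ereal_lt' ep0E).
pose d : R := N.+1%:R^-1%R.
have N01 : (0 < d <= 1)%R.
  apply/andP; split; first by rewrite invr_gt0.
  by rewrite -[leRHS]invr1 lef_pV2 ?posrE ?ler1n.
exists d => //; apply/lp_leP; first exact: ltW.
have /andP[_ N1] := N01.
rewrite (_ : `[0%R, _]%classic = D `&` `[0%R, d]%classic).
  by rewrite integral_mkcondr ltW.
apply/esym/setIidr => x; rewrite /D /= !in_itv/= => /andP[-> xN].
exact: le_trans N1.
Qed.

Lemma itvU_split (a b : R) : (0 <= a <= b)%R ->
  `[0%R, b]%classic = `[0%R, a]%classic `|` `[a, b]%classic.
Proof.
move=> /andP[a0 ab]; apply/seteqP; split => x /=; rewrite !in_itv/=.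
  move=> /andP[x0 xb]; case: (leP x a) => xa; [left|right]; rewrite ?x0//.
  by rewrite (ltW xa).
by move=> [/andP[x0 xa]|/andP[ax xb]]; [rewrite x0 (le_trans xa)|rewrite xb (le_trans a0)].
Qed.

(* A Vitali-type theorem: domination is only required away from 0, near which
   the sequence has uniformly small norm. *)
Lemma lp_cvg0 (f : nat -> R -> \bar R) (C : set R) :
  (forall n, measurable_fun setT (f n)) ->
  (forall n x, (0 <= x <= 1)%R -> 0 <= f n x) -> countable C ->
  (forall x, (0 < x <= 1)%R -> ~ C x ->
    forall e : R, (0 < e)%R -> \forall n \near \oo, f n x <= e%:E) ->
  (forall a : R, (0 < a <= 1)%R -> exists K : R,
    \forall n \near \oo, forall x, (a <= x <= 1)%R -> f n x <= K%:E) ->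
  (forall e : R, (0 < e)%R -> exists2 a : R, (0 < a <= 1)%R &
    \forall n \near \oo, lp `[0%R, a] (f n) <= e%:E) ->
  forall e : R, (0 < e)%R -> \forall n \near \oo, lp `[0%R, 1%R] (f n) <= e%:E.
Proof.
move=> mf f0 cC fC fK fa e e0.
have e20 : (0 < e / 2)%R by rewrite divr_gt0.
have [a a01 fae] := fa _ e20; have [K fnK] := fK _ a01.
have /andP[a0 a1] := a01.
have : \forall n \near \oo, lp `[a, 1%R] (f n) <= (e / 2)%:E.
  apply: (@lp_cvg0_bounded _ f C K) => //.
  - by move=> x /=; rewrite !in_itv/= => /andP[ax ->]; rewrite (le_trans _ ax)// ltW.
  - move=> n x /=; rewrite in_itv/= => /andP[ax x1].
    by apply: f0; rewrite x1 (le_trans _ ax)// ltW.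
  - move=> x /=; rewrite in_itv/= => /andP[ax x1].
    by apply: fC; rewrite x1 (lt_le_trans a0).
apply: filterS2 fae => n f1 f2; rewrite (@itvU_split a 1%R) ?(ltW a0)//.
apply: (le_trans (lp_setU _ _ _ _)) => //.
- by rewrite -itvU_split ?(ltW a0)// => x; exact: f0.
- by rewrite (splitr e) EFinD; exact: leeD.
Qed.

(** Monotone convergence along the intervals [[1/(n+1), b]], which exhaust []0, b]]; the endpoint 0
    is negligible. *)
Lemma lp_le_lim f (b e : R) : (0 <= e)%R -> measurable_fun setT f ->
  (forall a, (0 < a)%R -> lp `[a, b] f <= e%:E) -> lp `[0%R, b] f <= e%:E.
Proof.
move=> e0 mf fa; apply/lp_leP => //.
rewrite -integral_itv_obnd_cbnd; last exact: mpow.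
pose g n := (fun x => f x `^ p) \_ `[n.+1%:R^-1%R, b]%classic.
have mg n : measurable_fun setT (g n) by apply: measurable_fun_restrict => //; exact: mpow.
have g0 n x : 0 <= g n x by rewrite /g /patch; case: ifPn => // _; exact: poweR_ge0.
have gnd x : {homo g^~ x : n k / (n <= k)%N >-> n <= k}.
  move=> n k nk; rewrite {1}/g /patch; case: ifPn => [|_]; last exact: g0.
  rewrite inE/= in_itv/= => /andP[nx xb]; rewrite /g patchT// inE/= in_itv/= xb andbT.
  by rewrite (le_trans _ nx)// lef_pV2 ?posrE// ler_nat.
have mb : measurable (`]0%R, b] : set R) by [].
have := @cvg_monotone_convergence _ _ _ mu `]0%R, b]%classic mb g
  (fun n => measurable_funTS (mg n)) (fun n x _ => g0 n x) (fun x _ => gnd x).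
have gf : \int[mu]_(x in `]0%R, b]) limn (g^~ x) = \int[mu]_(x in `]0%R, b]) (f x `^ p).
  apply: eq_integral => x; rewrite inE/= in_itv/= => /andP[x0 xb].
  apply/cvg_lim => //; apply: cvg_near_cst.
  have [N _ HN] := near_infty_natSinv_lt (PosNum x0).
  exists N => // n /HN /= nx; rewrite /g patchT// inE/= in_itv/= xb andbT.
  exact: ltW.
move=> H; rewrite -gf -(cvg_lim _ H)//; apply: lime_le; first by apply/cvg_ex; eexists; exact: H.
apply: nearW => n; rewrite -integral_mkcondr.
have n0 : (0 < n.+1%:R^-1 :> R)%R by rewrite invr_gt0.
have [/(_ (fa _ n0)) + _] := lp_leP `[n.+1%:R^-1%R, b] f e0.
rewrite (_ : `]0%R, b]%classic `&` _ = `[n.+1%:R^-1%R, b]%classic)//.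
apply/setIidr => x /=; rewrite !in_itv/= => /andP[nx ->].
by rewrite (lt_le_trans n0 nx).
Qed.

End lp_seminorm.

(** * The metric d_p *)

Section dp_metric.
Context (R : realType) (m : nat) (p : R).
Hypothesis p1 : 1 <= p.
Implicit Types u v w : FB m p.
Local Open Scope ereal_scope.

Definition cut_dist (f g : 'rV[R]_m -> R) (a : R) : \bar R :=
  hausdorff_dist (alpha_cut f a) (alpha_cut g a).

Definition cut_norm (f : 'rV[R]_m -> R) (a : R) : \bar R :=
  hausdorff_dist (alpha_cut f a) [set 0%R].

Lemma dpE (f g : 'rV[R]_m -> R) : dp p f g = lp p `[0%R, 1%R] (cut_dist f g).
Proof. by []. Qed.

Lemma measurable_cut_dist f g : measurable_fun setT (cut_dist f g).
Proof.
exact (measurable_hausdorff_dist (@alpha_cut_antitone R m f) (@alpha_cut_antitone R m g)).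
Qed.

Lemma measurable_cut_norm f : measurable_fun setT (cut_norm f).
Proof.
exact (measurable_hausdorff_dist (B := fun=> [set 0%R])
  (@alpha_cut_antitone R m f) (fun _ _ _ => @subset_refl _ _)).
Qed.

Lemma cut_nonempty (f : 'rV[R]_m -> R) a : (exists x, f x = 1%R) -> (a <= 1)%R ->
  alpha_cut f a !=set0.
Proof.
move=> [x fx] a1; exists x; rewrite /alpha_cut; case: ifPn => _ /=; first by rewrite fx.
by apply: subset_closure; rewrite /= fx.
Qed.

Lemma cut_dist_ge0 f g a : (exists x, f x = 1%R) -> (a <= 1)%R -> 0 <= cut_dist f g a.
Proof. by move=> f1 a1; apply: hausdorff_dist_ge0; exact: cut_nonempty. Qed.

Lemma cut_norm_ge0 f a : (exists x, f x = 1%R) -> (a <= 1)%R -> 0 <= cut_norm f a.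
Proof. by move=> f1 a1; apply: hausdorff_dist_ge0; exact: cut_nonempty. Qed.

Lemma cut_dist_triangle g f h a : (exists x, f x = 1%R) -> (exists x, g x = 1%R) ->
  (exists x, h x = 1%R) -> (a <= 1)%R -> cut_dist f h a <= cut_dist f g a + cut_dist g h a.
Proof. by move=> *; apply: hausdorff_dist_triangle; exact: cut_nonempty. Qed.

Lemma cut_dist_le_norm f g a : (exists x, f x = 1%R) -> (exists x, g x = 1%R) ->
  (a <= 1)%R -> cut_dist f g a <= cut_norm f a + cut_norm g a.
Proof.
move=> *; rewrite /cut_norm (hausdorff_distC (alpha_cut g a)).
by apply: hausdorff_dist_triangle; try exact: cut_nonempty; exists 0%R.
Qed.

Lemma cut_norm_le_dist f g a : (exists x, f x = 1%R) -> (exists x, g x = 1%R) ->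
  (a <= 1)%R -> cut_norm f a <= cut_norm g a + cut_dist f g a.
Proof.
move=> *; rewrite addeC.
by apply: hausdorff_dist_triangle; try exact: cut_nonempty; exists 0%R.
Qed.

Lemma cut_norm_antitone f a b : (exists x, f x = 1%R) -> (a <= b)%R -> (b <= 1)%R ->
  cut_norm f b <= cut_norm f a.
Proof.
by move=> *; apply: le_hausdorff_dist0; [exact: cut_nonempty|exact: alpha_cut_antitone].
Qed.

Lemma dpC (f g : 'rV[R]_m -> R) : dp p f g = dp p g f.
Proof.
by rewrite !dpE; apply: eq_lp => a _; exact: hausdorff_distC.
Qed.

Lemma dpxx u : dp p u u = 0.
Proof.
apply/eqP; rewrite eq_le [X in _ && X]lp_ge0 andbT dpE.
apply: lp_le_cst => //; first exact: measurable_cut_dist.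
move=> a /=; rewrite in_itv/= => /andP[_ a1].
by rewrite /cut_dist hausdorff_distxx ?lexx//; apply: cut_nonempty => //; exact: FB_normal.
Qed.

Lemma dp_triangle v u w : dp p u w <= dp p u v + dp p v w.
Proof.
rewrite !dpE; apply: lp_minkowski => //; try exact: measurable_cut_dist;
  move=> a; rewrite /= in_itv/= => /andP[_ a1]; rewrite ?cut_dist_ge0//;
  try exact: FB_normal.
by apply: cut_dist_triangle => //; exact: FB_normal.
Qed.

Lemma dp_fuzzy0 (f : 'rV[R]_m -> R) : dp p f (@fuzzy0 R m) = lp p `[0%R, 1%R] (cut_norm f).
Proof.
rewrite dpE; apply: eq_lp => a /=; rewrite in_itv/= => /andP[_ a1].
by rewrite /cut_dist alpha_cut_fuzzy0.
Qed.

Lemma lp_cut_normy u : lp p `[0%R, 1%R] (cut_norm u) < +oo.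
Proof. exact: FB_pmean. Qed.

(** This transfers bounds on cut norms, over any part of [[0, 1]], from [v] to fuzzy sets close to
    [v]. *)
Lemma lp_cut_norm_le_dp u v (D : set R) : measurable D -> D `<=` `[0%R, 1%R] ->
  lp p D (cut_norm u) <= lp p D (cut_norm v) + dp p u v.
Proof.
move=> mD D01; apply: (@le_trans _ _ (lp p D (cut_norm v) + lp p D (cut_dist u v))); last first.
  by apply: leeD => //; apply: lp_subset => //; exact: measurable_cut_dist.
have D1 a : D a -> (a <= 1)%R by move=> /D01; rewrite /= in_itv/= => /andP[].
apply: (lp_minkowski p1 mD (measurable_cut_norm v) (measurable_cut_dist u v)
  (measurable_cut_norm u)) => a /D1 a1; rewrite ?cut_dist_ge0 ?cut_norm_ge0//; try exact: FB_normal.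
by apply: cut_norm_le_dist => //; exact: FB_normal.
Qed.

Lemma dp_lty u v : dp p u v < +oo.
Proof.
apply: (@le_lt_trans _ _ (lp p `[0%R, 1%R] (cut_norm u) + lp p `[0%R, 1%R] (cut_norm v))).
  rewrite dpE.
  apply: (lp_minkowski p1 _ (measurable_cut_norm u) (measurable_cut_norm v)
    (measurable_cut_dist u v)) => // a; rewrite /= in_itv/= => /andP[_ a1];
    rewrite ?cut_dist_ge0 ?cut_norm_ge0//;
    try exact: FB_normal.
  by apply: cut_dist_le_norm => //; exact: FB_normal.
by apply: lte_add_pinfty; exact: lp_cut_normy.
Qed.

Lemma open_dp_ball u (e : R) : open [set v : FB m p | dp p u v < e%:E].
Proof.
have : dp_open [set v : FB m p | dp p u v < e%:E].
  move=> v /= uv; exists (e - fine (dp p u v))%R.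
    rewrite subr_gt0 -lte_fin fineK// ge0_fin_numE ?dp_lty//; exact: lp_ge0.
  move=> w vw; apply: (le_lt_trans (dp_triangle v u w)).
  have uvE : dp p u v \is a fin_num by rewrite ge0_fin_numE ?dp_lty//; exact: lp_ge0.
  by rewrite -lteBrDl// -(fineK uvE) -EFinB.
by [].
Qed.

(** The topology was given by its open sets; the triangle inequality makes the balls open, which
    identifies the neighbourhoods. *)
Lemma nbhs_dpP u (A : set (FB m p)) :
  nbhs u A <-> exists2 e : R, (0 < e)%R & forall v, dp p u v < e%:E -> A v.
Proof.
split.
  rewrite nbhsE => -[W [Wo Wu] WA].
  have : dp_open W by exact: Wo.
  by move=> /(_ _ Wu)[e e0 eW]; exists e => // v /eW; exact: WA.
move=> [e e0 eA]; rewrite nbhsE; exists [set v : FB m p | dp p u v < e%:E] => //.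
by split; [exact: open_dp_ball|rewrite /= dpxx lte_fin].
Qed.

Lemma closure_dpP (U : set (FB m p)) u :
  closure U u <-> forall e : R, (0 < e)%R -> exists2 v, U v & dp p u v < e%:E.
Proof.
split=> [clu e e0|H].
  have [v [Uv uv]] : U `&` [set v : FB m p | dp p u v < e%:E] !=set0.
    by apply: clu; apply/nbhs_dpP; exists e.
  by exists v.
move=> A /nbhs_dpP[e e0 eA]; have [v Uv uv] := H _ e0.
by exists v; split => //; exact: eA.
Qed.

End dp_metric.

(** * Limits of fuzzy sets *)

Section ball_sup.
Context (R : realType) (m : nat).
Implicit Types (f : 'rV[R]_m -> R) (i : 'rV[rat]_m * nat).

Definition ball_sup f i : R := sup [set f x | x in rat_ball i].

Variable f : 'rV[R]_m -> R.
Hypothesis f01 : forall x, 0 <= f x <= 1.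

Let has_sup_ball i : has_sup [set f x | x in rat_ball i].
Proof.
split; first by exists (f (map_mx ratr i.1)), (map_mx ratr i.1) => //; exact: rat_ball_center.
by exists 1 => _ [x _ <-]; have /andP[] := f01 x.
Qed.

Lemma le_ball_sup i x : rat_ball i x -> f x <= ball_sup f i.
Proof. by move=> ix; apply: ub_le_sup; [have [] := has_sup_ball i|exists x]. Qed.

Lemma ball_sup_le1 i : ball_sup f i <= 1.
Proof.
apply: ge_sup; first by have [] := has_sup_ball i.
by move=> _ [x _ <-]; have /andP[] := f01 x.
Qed.

Lemma ball_sup_ge0 i : 0 <= ball_sup f i.
Proof.
apply: le_trans (le_ball_sup (rat_ball_center R i)).
by have /andP[] := f01 (map_mx ratr i.1).
Qed.

Lemma lt_ball_sup i a : a < ball_sup f i -> exists2 x, rat_ball i x & a < f x.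
Proof.
move=> ai; have d0 : 0 < ball_sup f i - a by rewrite subr_gt0.
have [_ [x ix <-] xa] := sup_adherent d0 (has_sup_ball i).
by exists x => //; move: xa; rewrite -/(ball_sup f i) subKr.
Qed.

End ball_sup.

(** With [A] a cut, these are the points that a set Hausdorff-close to [A] has to avoid. Compactness
    allows a pointwise strict bound there to be made uniform. *)
Lemma compact_euclid_far (R : realType) (m : nat) (A : set 'rV[R]_m) (r e : R) :
  compact ([set x | euclid_dist x 0 <= r] `&`
           [set x | forall y, A y -> e <= euclid_dist y x]).
Proof.
apply: (@compact_euclid _ _ _ r); first by move=> x [].
apply: closedI.
  rewrite (_ : [set _ | _] = [set x : 'rV[R]_m | euclid_dist 0 x <= r]).
    exact: closed_euclid_ball.
  by apply/seteqP; split => x; rewrite /= euclid_distC.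
rewrite (_ : [set x | _] = \bigcap_(y in A) ~` [set x | euclid_dist y x < e]); last first.
  apply/seteqP; split => x /= H y Ay; first by apply/negP; rewrite -leNgt; exact: H.
  by rewrite leNgt; apply/negP; exact: H.
apply: closed_bigI => y _; apply: open_closedC.
rewrite openE => x /= yx.
have xe : 0 < e - euclid_dist y x by rewrite subr_gt0.
apply: filterS (near_euclid_dist x xe) => z /=.
have := euclid_dist_triangle x y z; lra.
Qed.

Lemma closed_superlevel (T : topologicalType) (R : realType) (f : T -> R) (a : R) :
  upper_semicontinuous f -> closed [set x | a <= f x].
Proof.
move=> uscf x clx; rewrite /= leNgt; apply/negP => /uscf fxa.
by have [y [/= ay ya]] := clx _ fxa; move: ya; rewrite ltNge ay.
Qed.

(* The envelope is the hypograph (Gamma-) limit of any sequence of fuzzy sets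
   whose suprema over the rational balls converge to [s]. *)
Section envelope.
Context (R : realType) (m : nat).
Variables (s : 'rV[rat]_m * nat -> R) (v : nat -> 'rV[R]_m -> R).
Hypothesis v01 : forall n x, 0 <= v n x <= 1.
Hypothesis v_normal : forall n, exists x, v n x = 1.
Hypothesis v_s : forall i, ball_sup (v n) i @[n --> \oo] --> s i.
Hypothesis v_bnd : forall a, 0 < a <= 1 ->
  exists r, forall n x, a <= v n x -> euclid_dist x 0 <= r.

Definition envelope (x : 'rV[R]_m) : R := inf [set s i | i in [set i | rat_ball i x]].

Let near_lt i a : s i < a -> \forall n \near \oo, ball_sup (v n) i < a.
Proof. by move=> sa; have /cvgr_lt := v_s (i := i); exact. Qed.

Let near_gt i a : a < s i -> \forall n \near \oo, a < ball_sup (v n) i.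
Proof. by move=> sa; have /cvgr_gt := v_s (i := i); exact. Qed.

Let s_ge0 i : 0 <= s i.
Proof.
rewrite leNgt; apply/negP => /near_lt[N _ /(_ N (leqnn _))] /=.
by rewrite ltNge ball_sup_ge0.
Qed.

Let s_le1 i : s i <= 1.
Proof.
rewrite leNgt; apply/negP => /near_gt[N _ /(_ N (leqnn _))] /=.
by rewrite ltNge ball_sup_le1.
Qed.

Let has_inf_s (x : 'rV[R]_m) : has_inf [set s i | i in [set i | rat_ball i x]].
Proof.
split; last by exists 0 => _ [i _ <-].
by have [i ix _] := rat_ball_base (@filterT _ _ (nbhs_filter x)); exists (s i), i.
Qed.

Lemma envelope_le i (x : 'rV[R]_m) : rat_ball i x -> envelope x <= s i.
Proof. by move=> ix; apply: ge_inf; [have [] := has_inf_s x|exists i]. Qed.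

Lemma envelope_lt x a : envelope x < a -> exists2 i, rat_ball i x & s i < a.
Proof.
move=> xa; have d0 : 0 < a - envelope x by rewrite subr_gt0.
have [_ [i ix <-] si] := inf_adherent d0 (has_inf_s x).
by exists i => //; move: si; rewrite -/(envelope x) subrKC.
Qed.

Lemma envelope_itv x : 0 <= envelope x <= 1.
Proof.
have [[_ [i ix _]] _] := has_inf_s x.
rewrite (le_trans (envelope_le ix))// andbT; apply: lb_le_inf.
  by have [] := has_inf_s x.
by move=> _ [j _ <-].
Qed.

Lemma envelope_usc : upper_semicontinuous envelope.
Proof.
move=> x a /envelope_lt[i ix sa].
have : nbhs x (rat_ball i) by apply: open_nbhs_nbhs; split => //; exact: open_rat_ball.
by apply: filterS => y iy; apply: le_lt_trans sa; exact: envelope_le.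
Qed.

(** Each point of [K] lies in a rational ball with [s i < a], on which [v n] is eventually below
    [a]; finitely many such balls cover [K]. *)
Lemma near_lt_on_compact (K : set 'rV[R]_m) a : compact K ->
  (forall x, K x -> envelope x < a) -> \forall n \near \oo, forall x, K x -> v n x < a.
Proof.
move=> /compact_near_coveringP cK Ka.
have := cK nat \oo (fun n x => v n x < a) _.
apply => x /Ka /envelope_lt[i ix sa].
exists (rat_ball i, [set n | ball_sup (v n) i < a]) => /=.
  split; last exact: near_lt.
  by apply: open_nbhs_nbhs; split => //; exact: open_rat_ball.
by move=> [y n] /= [iy na]; apply: le_lt_trans na; exact: le_ball_sup.
Qed.

(** The points where the [v n] take the value 1 stay in a fixed closed ball. If the envelope were
    below 1 on it, so would [v n] be for large [n]. *)
Lemma envelope_normal : exists x, envelope x = 1.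
Proof.
have [r rP] := v_bnd (a := 1) ltac:(by rewrite ltr01 lexx).
apply: contrapT => /forallNP none.
(* With [set0] the second condition is vacuous, and the set is the closed ball of radius [r]. *)
have := @compact_euclid_far R m set0 r 0.
move=> /near_lt_on_compact => /(_ 1) [|N _ /(_ N (leqnn _)) /= H].
  move=> x _; rewrite lt_neqAle; have /andP[_ ->] := envelope_itv x.
  by rewrite andbT; apply/eqP; exact: none.
have [x vx] := v_normal N.
have xr : euclid_dist x 0 <= r by apply: (rP N); rewrite vx.
by have := H x (conj xr (fun=> False_ind _)); rewrite vx ltxx.
Qed.

Lemma envelope_bnd a : 0 < a <= 1 ->
  exists r, forall x, a <= envelope x -> euclid_dist x 0 <= r.
Proof.
(* Passing to [a / 2] gives the strict inequality [a / 2 < s i] on a ball around [x]; some [v N]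
   then exceeds [a / 2] within distance 1 of [x], whence the radius [r + 1]. *)
move=> /andP[a0 a1]; have [r rP] := v_bnd (a := a / 2) ltac:(lra).
exists (r + 1) => x ax.
have [i ix iB] := rat_ball_base (near_euclid_dist x (@ltr01 R)).
have : a / 2 < s i by have := envelope_le ix; lra.
move=> /near_gt[N _ /(_ N (leqnn _)) /= /(lt_ball_sup (v01 N))[y /iB /= xy /ltW /rP]].
have := euclid_dist_triangle y x 0; lra.
Qed.

(** The points of norm at most [r] that are [e]-far from the cut of the envelope form a compact set
    where the envelope is below [a]; eventually [v n] is below [a] there too. *)
Lemma near_excess_envelope_le a e : 0 < a <= 1 -> 0 < e ->
  \forall n \near \oo, forall x, a <= v n x -> exists2 y, a <= envelope y & euclid_dist x y <= e.
Proof.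
move=> a01 e0; have [r rP] := v_bnd a01; have /andP[a0 a1] := a01.
pose K := [set x : 'rV[R]_m | euclid_dist x 0 <= r] `&`
  [set x | forall y, a <= envelope y -> e <= euclid_dist y x].
have cK : compact K by exact: compact_euclid_far.
have : forall x, K x -> envelope x < a.
  move=> x [_ Kx]; rewrite ltNge; apply/negP => ax.
  by have := Kx x ax; rewrite euclid_distxx leNgt e0.
move=> /(near_lt_on_compact cK); apply: filterS => n nK x vx.
apply: contrapT => noy.
have /nK : K x; last by rewrite ltNge vx.
split; first exact: rP vx.
move=> y ay; rewrite leNgt; apply/negP => yx; apply: noy.
by exists y => //; rewrite euclid_distC ltW.
Qed.

(** Since [a] is not a value of [s], a ball meeting the cut of the envelope has [a < s i] strictly,
    so [v n] eventually exceeds [a] somewhere in it. Compactness of the cut makes this uniform. *)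
Lemma near_excess_le_envelope a e : 0 < a <= 1 -> ~ range s a -> 0 < e ->
  \forall n \near \oo, forall x, a <= envelope x -> exists2 y, a <= v n y & euclid_dist x y <= e.
Proof.
move=> a01 sa e0; have [r rP] := envelope_bnd a01; have /andP[a0 a1] := a01.
have : compact [set x | a <= envelope x].
  by apply: (compact_euclid rP); apply: closed_superlevel; exact: envelope_usc.
move=> /compact_near_coveringP cK.
have := cK nat \oo (fun n x => exists2 y, a <= v n y & euclid_dist x y <= e) _.
apply => x /= ax.
have e20 : 0 < e / 2 by rewrite divr_gt0.
have [i ix iB] := rat_ball_base (near_euclid_dist x e20).
have asi : a < s i.
  rewrite lt_neqAle (le_trans ax (envelope_le ix)) andbT.
  by apply/eqP => asi; apply: sa; exists i.
exists (rat_ball i, [set n | a < ball_sup (v n) i]) => /=.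
  split; last exact: near_gt.
  by apply: open_nbhs_nbhs; split => //; exact: open_rat_ball.
move=> [z n] /= [/iB/= xz /(lt_ball_sup (v01 n))[y /iB/= xy /ltW ay]].
exists y => //; have := euclid_dist_triangle x z y.
rewrite (euclid_distC z x); lra.
Qed.

Lemma near_cut_dist_envelope a e : 0 < a <= 1 -> ~ range s a -> 0 < e ->
  \forall n \near \oo, (cut_dist (v n) envelope a <= e%:E)%E.
Proof.
move=> a01 sa e0; have /andP[a0 a1] := a01.
apply: filterS2 (near_excess_envelope_le a01 e0) (near_excess_le_envelope a01 sa e0).
by move=> n n1 n2; apply: hausdorff_dist_le; rewrite !alpha_cut_gt0.
Qed.

End envelope.

(** * Bounding a single cut by the mean norm *)

Section cut_norm_bounds.
Context (R : realType) (m : nat) (p : R).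
Hypothesis p1 : 1 <= p.
Local Open Scope ereal_scope.

Lemma cut_norm_le (f : 'rV[R]_m -> R) (M a : R) : (exists x, f x = 1%R) -> (0 < a <= 1)%R ->
  lp p `[0%R, 1%R] (cut_norm f) <= M%:E -> cut_norm f a <= (M / a `^ p^-1)%:E.
Proof.
move=> f1 a01 fM; have /andP[a0 a1] := a01.
have ap0 : (0 < a `^ p^-1)%R by rewrite powR_gt0.
(* The cut norm decreases with the level, so a lower bound at [a] holds on [[0, a]]. The bound is
   stated for real [K] because the cut norm might be infinite; that case is excluded below by taking
   [K] one above the bound. *)
have bound (K : R) : (0 <= K)%R -> K%:E <= cut_norm f a -> (K <= M / a `^ p^-1)%R.
  move=> K0 Kf; rewrite ler_pdivlMr// -lee_fin.
  apply: le_trans fM; apply: (le_lp_cst p1 (measurable_cut_norm f)) => // x /andP[_ xa].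
  by apply: (le_trans Kf); exact: cut_norm_antitone.
have := cut_norm_ge0 f1 a1; move: bound; case: (cut_norm f a) => [r| |]//= bound r0.
  by rewrite lee_fin; apply: bound.
have M0 : (0 <= M)%R by rewrite -lee_fin; apply: le_trans fM; exact: lp_ge0.
have z0 : (0 <= M / a `^ p^-1)%R by rewrite divr_ge0// ltW.
have := bound (M / a `^ p^-1 + 1)%R (addr_ge0 z0 ler01) (leey _).
by rewrite gerDl leNgt ltr01.
Qed.

Lemma cut_norm_leP (f : 'rV[R]_m -> R) (r a : R) : (exists x, f x = 1%R) -> (0 < a <= 1)%R ->
  cut_norm f a <= r%:E <-> forall x, (a <= f x)%R -> (euclid_dist x 0 <= r)%R.
Proof.
move=> f1 /andP[a0 a1]; rewrite /cut_norm -[X in _ <-> X]/(forall x, [set x | (a <= f x)%R] x -> _).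
by rewrite -alpha_cut_gt0//; apply: hausdorff_dist0_leP; exact: cut_nonempty.
Qed.

End cut_norm_bounds.

(** * Convergence to the envelope in the mean metric *)

Section envelope_convergence.
Context (R : realType) (m : nat) (p : R).
Hypothesis p1 : 1 <= p.
Variables (s : 'rV[rat]_m * nat -> R) (v : nat -> FB m p).
Hypothesis v_s : forall i, ball_sup (v n) i @[n --> \oo] --> s i.
Hypothesis v_bnd : forall a, 0 < a <= 1 ->
  exists K : R, forall n, (cut_norm (v n) a <= K%:E)%E.
Hypothesis v_near0 : forall e : R, 0 < e -> exists2 a : R, 0 < a <= 1 &
  forall n, (lp p `[0%R, a] (cut_norm (v n)) <= e%:E)%E.

Let v01 n x : 0 <= v n x <= 1. Proof. exact: FB_itv. Qed.
Let v1 n : exists x, v n x = 1. Proof. exact: FB_normal. Qed.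

Let v_bnd' a : 0 < a <= 1 -> exists r, forall n x, a <= v n x -> euclid_dist x 0 <= r.
Proof.
move=> a01; have [K vK] := v_bnd a01; exists K => n.
by apply/(cut_norm_leP _ (v1 n) a01); exact: vK.
Qed.

Let env1 := envelope_normal v01 v1 v_s v_bnd'.

Let env_bnd a : 0 < a <= 1 -> exists K : R, (cut_norm (envelope s) a <= K%:E)%E.
Proof.
move=> a01; have [r rP] := envelope_bnd v01 v_s v_bnd' a01.
by exists r; apply/(cut_norm_leP _ env1 a01).
Qed.

Let dist_bnd a : 0 < a <= 1 -> exists K : R, forall n x, a <= x <= 1 ->
  (cut_dist (v n) (envelope s) x <= K%:E)%E.
Proof.
move=> a01; have [K1 K1P] := v_bnd a01; have [K2 K2P] := env_bnd a01.
exists (K1 + K2) => n x /andP[ax x1].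
apply: (le_trans (cut_dist_le_norm (v1 n) env1 x1)); rewrite EFinD; apply: leeD.
  by apply: le_trans (K1P n); exact: cut_norm_antitone.
by apply: le_trans K2P; exact: cut_norm_antitone.
Qed.

Let cs : countable (range s).
Proof. by apply: (sub_countable (card_le_trans (card_image_le _ _) _)) => //. Qed.

Let near_dist a e : 0 < a <= 1 -> 0 < e ->
  \forall n \near \oo, (lp p `[a, 1%R] (cut_dist (v n) (envelope s)) <= e%:E)%E.
Proof.
move=> a01 e0; have [K vK] := dist_bnd a01; have /andP[a0 a1] := a01.
apply: (lp_cvg0_bounded p1 (C := range s) (K := K)) => //.
- by move=> x /=; rewrite !in_itv/= => /andP[ax ->]; rewrite (le_trans (ltW a0) ax).
- by move=> n; exact: measurable_cut_dist.
- by move=> n x /=; rewrite in_itv/= => /andP[_ x1]; exact: cut_dist_ge0.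
- move=> x /=; rewrite in_itv/= => /andP[ax x1] sx d d0.
  by apply: (near_cut_dist_envelope v01 v_s v_bnd') => //; rewrite x1 (lt_le_trans a0).
- by apply: nearW => n x /=; rewrite in_itv/=; exact: vK.
Qed.

(** On [[b, a]] with [b > 0] the envelope is close in norm to some [v N], which satisfies the bound;
    then [b] tends to 0. *)
Let lp_envelope_near0 a e : 0 < a <= 1 -> 0 <= e ->
  (forall n, (lp p `[0%R, a] (cut_norm (v n)) <= e%:E)%E) ->
  (lp p `[0%R, a] (cut_norm (envelope s)) <= e%:E)%E.
Proof.
move=> /andP[a0 a1] e0 ve; apply: (lp_le_lim p1) => //; first exact: measurable_cut_norm.
move=> b b0; apply/lee_addgt0Pr => d d0.
(* [near_dist] requires a level at most 1, whereas [b] is any positive number; [[b, a]] is contained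
   in [[min b 1, 1]]. *)
have b01 : 0 < Num.min b 1 <= 1 by rewrite lt_min b0 ltr01 ge_min lexx orbT.
have [N _ /(_ N (leqnn _)) /= dN] := near_dist b01 d0.
apply: (@le_trans _ _ (lp p `[b, a] (cut_norm (v N)) +
    lp p `[b, a] (cut_dist (v N) (envelope s)))%E).
  apply: (lp_minkowski p1 _ (measurable_cut_norm _) (measurable_cut_dist _ _)
    (measurable_cut_norm _)) => //= x; rewrite in_itv/= => /andP[_ /le_trans/(_ a1) x1].
  - exact: cut_norm_ge0.
  - exact: cut_dist_ge0.
  - rewrite cut_norm_ge0//= /cut_dist hausdorff_distC; exact: cut_norm_le_dist.
apply: leeD.
  apply: le_trans (ve N); apply: (lp_subset p1) => //; first exact: measurable_cut_norm.
  by move=> x /=; rewrite !in_itv/= => /andP[/(le_trans (ltW b0)) -> ->].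
apply: le_trans dN; apply: (lp_subset p1) => //; first exact: measurable_cut_dist.
move=> x /=; rewrite !in_itv/= => /andP[bx xa].
by rewrite ge_min bx (le_trans xa).
Qed.

Let lp_envelope_lty : (origin_mean p (envelope s) < +oo)%E.
Proof.
have [a a01 va] := v_near0 (e := 1) ltr01.
have /andP[a0 a1] := a01; have [K KP] := env_bnd a01.
change (lp p `[0%R, 1%R] (cut_norm (envelope s)) < +oo)%E.
rewrite (@itvU_split _ a 1) ?(ltW a0)//.
apply: (le_lt_trans (lp_setU p1 _ _ (measurable_cut_norm _) _)) => //.
  by rewrite -itvU_split ?(ltW a0)// => x /=; rewrite in_itv/= => /andP[_]; exact: cut_norm_ge0.
apply: lte_add_pinfty.
  exact: le_lt_trans (lp_envelope_near0 a01 ler01 va) (ltry _).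
apply: (@le_lt_trans _ _ (Num.max K 0)%:E); last exact: ltry.
apply: (lp_le_cst p1 _ (measurable_cut_norm _)) => //.
- by move=> x /=; rewrite !in_itv/= => /andP[/(le_trans (ltW a0)) -> ->].
- by rewrite le_max lexx orbT.
- move=> x /=; rewrite in_itv/= => /andP[ax x1]; rewrite cut_norm_ge0//=.
  apply: (le_trans (cut_norm_antitone env1 ax x1)); apply: (le_trans KP).
  by rewrite lee_fin le_max lexx.
Qed.

Lemma envelope_FB : exists u : FB m p, FB_fun u = envelope s.
Proof.
exists (MkFB (envelope_itv v01 v_s) env1 (envelope_usc v01 v_s) lp_envelope_lty).
by [].
Qed.

Lemma envelope_cvg e : 0 < e -> \forall n \near \oo, (dp p (v n) (envelope s) <= e%:E)%E.
Proof.
move=> e0; apply: (@lp_cvg0 _ _ p1 (fun n => cut_dist (v n) (envelope s)) (range s)) => //.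
- by move=> n; exact: measurable_cut_dist.
- by move=> n x /andP[_ x1]; exact: cut_dist_ge0.
- by move=> x x01 sx d d0; exact: (near_cut_dist_envelope v01 v_s v_bnd').
- by move=> a a01; have [K vK] := dist_bnd a01; exists K; apply: nearW => n x; exact: vK.
- move=> d d0; have d20 : 0 < d / 2 by rewrite divr_gt0.
  have [a a01 va] := v_near0 d20; exists a => //; apply: nearW => n.
  have /andP[a0 a1] := a01.
  rewrite (splitr d) EFinD; apply: (@le_trans _ _ (lp p `[0%R, a] (cut_norm (v n)) +
    lp p `[0%R, a] (cut_norm (envelope s)))%E); last first.
    by apply: leeD => //; apply: lp_envelope_near0 => //; exact: ltW.
  apply: (lp_minkowski p1 _ (measurable_cut_norm _) (measurable_cut_norm _)
    (measurable_cut_dist _ _)) => //= x; rewrite in_itv/= => /andP[_ /le_trans/(_ a1) x1].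
  - exact: cut_norm_ge0.
  - exact: cut_norm_ge0.
  - by rewrite cut_dist_ge0//=; exact: cut_dist_le_norm.
Qed.

End envelope_convergence.

Lemma ultra_cvg_segment (T : Type) (R : realType) (F : set_system T) (f : T -> R) (a b : R) :
  UltraFilter F -> (forall x, a <= f x <= b) -> exists l : R, f x @[x --> F] --> l.
Proof.
move=> FU fab; have FP : ProperFilter F by exact: ultra_proper.
have Fab : F (f @^-1` `[a, b]%classic) by apply: filterE => x; rewrite /= in_itv/=.
have [l [_ lcl]] := segment_compact (fmap_proper_filter f FP) Fab.
exists l => A lA; have [//|FA] := in_ultra_setVsetC (f @^-1` A) FU.
by have [x []] := lcl _ _ (FA : (f x @[x --> F]) (~` A)) lA.
Qed.

(** * Compactness *)

Section compactness.
Context (R : realType) (m : nat) (p : R).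
Hypothesis p1 : 1 <= p.

(** The domination away from 0 and the smallness near 0 required by [lp_cvg0], made uniform over
    [V]. *)
Definition cut_tight (V : set (FB m p)) : Prop :=
  (forall a, 0 < a <= 1 -> exists K : R, forall v, V v -> (cut_norm v a <= K%:E)%E) /\
  (forall e : R, 0 < e -> exists2 a : R, 0 < a <= 1 &
    forall v, V v -> (lp p `[0%R, a] (cut_norm v) <= e%:E)%E).

(** Only the balls with code below [n] are controlled, so membership is a finite condition and can
    belong to a filter; yet a sequence with [v n] in the [n]-th set has all its suprema converging
    to [s]. *)
Let near_profile (s : 'rV[rat]_m * nat -> R) (n : nat) : set (FB m p) :=
  [set w | forall i, (pickle i < n)%N -> `|s i - ball_sup w i| < n.+1%:R^-1].

Let near_profile_cvg s (v : nat -> FB m p) : (forall n, near_profile s n (v n)) ->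
  forall i, ball_sup (v n) i @[n --> \oo] --> s i.
Proof.
move=> sv i; apply/cvgrPdist_lt => e e0.
have [N _ HN] := near_infty_natSinv_lt (PosNum e0).
exists (maxn N (pickle i).+1) => // n /=; rewrite geq_max => /andP[Nn ni].
by apply: lt_trans (HN n Nn); exact: sv.
Qed.

(** The suprema over balls converge along an ultrafilter and define a profile [s]. The sets
    [near_profile s n] belong to the ultrafilter and reduce its convergence to that of sequences
    chosen from them. *)
Lemma tight_closed_compact (V : set (FB m p)) : cut_tight V -> closed V -> compact V.
Proof.
move=> [Vbnd Vnear0] clV; rewrite compact_ultra => F FU FV.
have FP : ProperFilter F by exact: ultra_proper.
have /choice[s sP] : forall i, exists l : R, ball_sup (w : FB m p) i @[w --> F] --> l.
  move=> i; apply: (@ultra_cvg_segment _ _ F _ 0 1) => w.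
  by rewrite ball_sup_ge0 ?ball_sup_le1//; exact: FB_itv.
have Fs n : F (near_profile s n).
  (* A finite intersection, built by induction on the code: at most one ball has code [k], and
     possibly none. *)
  have Fk k : F [set w : FB m p | forall i, (pickle i < k)%N ->
      `|s i - ball_sup w i| < n.+1%:R^-1].
    elim: k => [|k IH]; first by apply: filterE.
    have : F [set w : FB m p | forall i, pickle i = k -> `|s i - ball_sup w i| < n.+1%:R^-1].
      have [[i ik]|nok] := pselect (exists i : 'rV[rat]_m * nat, pickle i = k).
        have n0 : 0 < n.+1%:R^-1 :> R by rewrite invr_gt0.
        have /cvgrPdist_lt/(_ _ n0) := sP i; apply: filterS => w iw j jk.
        suff -> : j = i by [].
        by apply: (pcan_inj pickleK); rewrite jk.
      by apply: filterE => w i ik; exfalso; apply: nok; exists i.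
    move: IH; apply: filterS2 => w wk wk' i.
    by rewrite ltnS leq_eqVlt => /orP[/eqP|]; [exact: wk'|exact: wk].
  exact: Fk.
have FVs n : F (V `&` near_profile s n) by exact: filterI.
have Vcvg (v : nat -> FB m p) : (forall n, (V `&` near_profile s n) (v n)) ->
    (exists u : FB m p, FB_fun u = envelope s) /\
    forall e, 0 < e -> \forall n \near \oo, (dp p (v n) (envelope s) <= e%:E)%E.
  move=> vP; have vs := near_profile_cvg (fun n => (vP n).2).
  have vbnd a : 0 < a <= 1 -> exists K : R, forall n, (cut_norm (v n) a <= K%:E)%E.
    by move=> /Vbnd[K VK]; exists K => n; exact: VK (vP n).1.
  have vnear0 e : 0 < e -> exists2 a : R, 0 < a <= 1 &
      forall n, (lp p `[0%R, a] (cut_norm (v n)) <= e%:E)%E.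
    by move=> /Vnear0[a a01 Va]; exists a => // n; exact: Va (vP n).1.
  split; first exact: (envelope_FB p1 vs vbnd vnear0).
  by move=> e e0; exact: (envelope_cvg p1 vs vbnd vnear0).
have [u uE] : exists u : FB m p, FB_fun u = envelope s.
  have /choice[v vP] : forall n, exists w, (V `&` near_profile s n) w.
    by move=> n; exact: filter_ex (FVs n).
  by have [] := Vcvg v vP.
have Fball e : 0 < e -> F [set w : FB m p | (dp p u w < e%:E)%E].
  (* Otherwise each of these sets has a point outside the [d_p]-ball; the sequence of such points
     would still converge to the envelope, that is, to [u]. *)
  move=> e0; suff [n nP] : exists n, V `&` near_profile s n `<=` [set w | (dp p u w < e%:E)%E].
    exact: filterS (FVs n).
  apply: contrapT => /forallNP none.
  have /choice[v vP] : forall n, exists w, (V `&` near_profile s n) w /\ ~ (dp p u w < e%:E)%E.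
    by move=> n; have /existsNP[w /not_implyP[]] := none n; exists w.
  have e20 : 0 < e / 2 by rewrite divr_gt0.
  have [_ /(_ _ e20)[N _ /(_ N (leqnn _))/= vN]] := Vcvg v (fun n => (vP n).1).
  have [_] := vP N; apply; rewrite dpC uE; apply: (le_lt_trans vN).
  by rewrite lte_fin ltr_pdivrMr// ltr_pMr// ltr1n.
have Fu : F --> u.
  by move=> A /(nbhs_dpP p1)[e e0 eA]; apply: filterS (Fball _ e0) => w; exact: eA.
exists u; split => //; apply: clV; apply/(closure_dpP p1) => e e0.
have [w [Vw uw]] := filter_ex (filterI FV (Fball _ e0)).
by exists w.
Qed.

End compactness.

(** * Mean left continuity *)

Section shift.
Context (R : realType) (m : nat) (p : R).
Hypothesis p1 : 1 <= p.
Implicit Types (u v : FB m p) (h : R).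

Definition shift_dist (f : 'rV[R]_m -> R) h (a : R) : \bar R :=
  hausdorff_dist (alpha_cut f a) (alpha_cut f (a - h)).

Lemma measurable_shift_dist f h : measurable_fun setT (shift_dist f h).
Proof.
have shift_anti a b : a <= b -> alpha_cut f (b - h) `<=` alpha_cut f (a - h).
  by move=> ab; apply: alpha_cut_antitone; rewrite lerD2r.
exact (measurable_hausdorff_dist (@alpha_cut_antitone R m f) shift_anti).
Qed.

Lemma measurable_shift (f : R -> \bar R) (c : R) : measurable_fun setT f ->
  measurable_fun setT (fun x : R => f (x - c)).
Proof. by move=> mf; apply: (measurableT_comp mf); exact: measurable_funB. Qed.

Let le1B h a : 0 <= h -> a <= 1 -> a - h <= 1.
Proof. by move=> h0 a1; rewrite (le_trans _ a1)// gerBl. Qed.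

Lemma shift_dist_ge0 u h a : a <= 1 -> (0 <= shift_dist u h a)%E.
Proof. by move=> a1; apply: hausdorff_dist_ge0; apply: cut_nonempty => //; exact: FB_normal. Qed.

Lemma shift_dist_le_norm u h a : 0 <= h -> a <= 1 ->
  (shift_dist u h a <= cut_norm u a + cut_norm u (a - h))%E.
Proof.
move=> h0 a1; rewrite /cut_norm [X in (_ + X)%E]hausdorff_distC.
apply: hausdorff_dist_triangle; last 1 first.
- by apply: cut_nonempty; [exact: FB_normal|exact: le1B].
- by apply: cut_nonempty => //; exact: FB_normal.
- by exists 0.
Qed.

Lemma lp_itv_shift (f : R -> \bar R) (a b c : R) : measurable_fun setT f ->
  lp p `[a, b] (fun x => f (x - c)) = lp p `[a - c, b - c] f.
Proof.
move=> mf; rewrite -(@lp_translate _ p `[a - c, b - c]%classic f c)//.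
by congr lp; apply/seteqP; split => x /=; rewrite !in_itv/= !lerD2r.
Qed.

(** The points of the [a / 2]-cut that are [e]-far from the [a]-cut form a compact set where
    [u < a]. By upper semicontinuity [u < a - h] on it for all small [h], so the [a - h]-cut avoids
    it. *)
Lemma shift_dist_cvg0 u a e : 0 < a <= 1 -> 0 < e ->
  exists2 d, 0 < d & forall h, 0 <= h < d -> (shift_dist u h a <= e%:E)%E.
Proof.
move=> /andP[a0 a1] e0.
have u1 := FB_normal u.
have [r rP] : exists r, forall x, a / 2 <= u x -> euclid_dist x 0 <= r.
  have a201 : 0 < a / 2 <= 1 by lra.
  have := lp_cut_normy u.
  have := lp_ge0 p `[0%R, 1%R] (cut_norm u).
  case E: (lp _ _ _) => [M| |]// _ _; exists (M / (a / 2) `^ p^-1).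
  by apply/(cut_norm_leP _ u1 a201); apply: (cut_norm_le p1) => //; rewrite E.
pose K := [set x : 'rV[R]_m | a / 2 <= u x] `&`
  ([set x : 'rV[R]_m | euclid_dist x 0 <= r] `&`
   [set x | forall y, a <= u y -> e <= euclid_dist y x]).
have cK : compact K.
  rewrite /K setIC; apply: compact_closedI; first exact: compact_euclid_far.
  by apply: closed_superlevel; exact: FB_usc.
have Ka x : K x -> u x < a.
  move=> [_ [_ Kx]]; rewrite ltNge; apply/negP => ax.
  by have := Kx x ax; rewrite euclid_distxx leNgt e0.
have /compact_near_coveringP/(_ R (nbhs (0 : R)) (fun h x => u x < a - h) _) := cK.
case.
  (* The midpoint [b] splits the gap: near [x] one has [u < b], and small [h] satisfy
     [b < a - h]. *)
  move=> x /Ka uxa; pose b := (u x + a) / 2.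
  exists ([set y | u y < b], [set h | h < a - b]) => /=.
    split; first by apply: FB_usc; rewrite /b; lra.
    by apply: (@lt_nbhsl R 0 (a - b)); rewrite /b; lra.
  by move=> [y h] /= [yb hb]; lra.
(* The bound [a / 2] keeps [a - h] above [a / 2], so that the shifted cut lies in the region where
   [K] is defined. *)
move=> d /= d0 dP; exists (Num.min d (a / 2)); first by rewrite lt_min d0/=; lra.
move=> h /andP[h0]; rewrite lt_min => /andP[hd ha].
have ah0 : 0 < a - h by lra.
apply: hausdorff_dist_le; rewrite !alpha_cut_gt0// => x /= ax.
  by exists x; [rewrite /=; lra|rewrite euclid_distxx ltW].
apply: contrapT => noy.
have Kx : K x.
  have ux : a / 2 <= u x by lra.
  split => //; split; first exact: rP.
  move=> y ay; rewrite leNgt; apply/negP => yx; apply: noy.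
  by exists y => //; rewrite euclid_distC ltW.
have /dP/(_ _ Kx) : ball (0 : R) d h by rewrite /ball/= sub0r normrN ger0_norm.
lra.
Qed.

Lemma lp_shift_dist_le u h a : 0 <= h -> a <= 1 ->
  (lp p `[h, a] (shift_dist u h) <=
   lp p `[0%R, a] (cut_norm u) + lp p `[0%R, a] (cut_norm u))%E.
Proof.
move=> h0 a1.
apply: (@le_trans _ _ (lp p `[h, a] (cut_norm u) +
    lp p `[h, a] (fun x => cut_norm u (x - h)))%E).
  apply: (lp_minkowski p1 _ (measurable_cut_norm u)
    (measurable_shift h (measurable_cut_norm u)) (measurable_shift_dist u h)) => //= x;
    rewrite in_itv/= => /andP[_ /le_trans/(_ a1) x1].
  - by apply: cut_norm_ge0 => //; exact: FB_normal.
  - by apply: cut_norm_ge0; [exact: FB_normal|exact: le1B].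
  - by rewrite shift_dist_ge0// shift_dist_le_norm.
apply: leeD.
  apply: (lp_subset p1) => //; first exact: measurable_cut_norm.
  by move=> x /=; rewrite !in_itv/= => /andP[/(le_trans h0) -> ->].
rewrite lp_itv_shift ?subrr; last exact: measurable_cut_norm.
apply: (lp_subset p1) => //; first exact: measurable_cut_norm.
move=> x /=; rewrite !in_itv/= => /andP[-> /le_trans -> //].
by rewrite gerBl.
Qed.

(** A failure would give shifts [h n] tending to 0 with large norms, against [lp_cvg0]. *)
Lemma FB_pmean_left_continuous u e : 0 < e -> exists2 d, 0 < d &
  forall h, 0 <= h < d -> (lp p `[h, 1%R] (shift_dist u h) <= e%:E)%E.
Proof.
move=> e0; apply: contrapT => none.
have /choice[h hP] : forall n : nat, exists h, 0 <= h < n.+1%:R^-1 /\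
    ~ (lp p `[h, 1%R] (shift_dist u h) <= e%:E)%E.
  move=> n; apply: contrapT => /forallNP noh; apply: none.
  exists n.+1%:R^-1; first by rewrite invr_gt0.
  by move=> h hn; apply: contrapT => hh; apply: (noh h).
have h0 n : 0 <= h n by have [/andP[]] := hP n.
have near_h d : 0 < d -> \forall n \near \oo, h n < d.
  move=> d0; have [N _ HN] := near_infty_natSinv_lt (PosNum d0).
  exists N => // n /HN; apply: lt_trans.
  by have [/andP[]] := hP n.
(* Extension by 0 below [h n] replaces the moving domain [[h n, 1]] by the fixed one [[0, 1]]. *)
pose f n := (shift_dist u (h n)) \_ `[h n, 1%R]%classic.
have fE n x : x <= 1 -> (0 <= f n x <= shift_dist u (h n) x)%E.
  move=> x1; rewrite /f /patch; case: ifPn => _; by rewrite lexx shift_dist_ge0.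
have lpf n a : 0 <= a -> a <= 1 -> lp p `[0%R, a] (f n) = lp p `[h n, a] (shift_dist u (h n)).
  move=> a0 a1; rewrite lp_restrict//; congr lp; apply/seteqP; split => x /=.
    by rewrite !in_itv/= => -[/andP[_ ->] /andP[->]].
  rewrite !in_itv/= => /andP[hx xa]; rewrite hx xa (le_trans xa a1) (le_trans (h0 n) hx).
  by [].
have : \forall n \near \oo, (lp p `[0%R, 1%R] (f n) <= e%:E)%E.
  apply: (@lp_cvg0 _ _ p1 f set0) => //.
  - by move=> n; apply: (measurable_fun_restrict _ (measurable_shift_dist u (h n))).
  - by move=> n x /andP[_ x1]; have /andP[] := fE n x x1.
  - move=> x x01 _ d d0; have [b b0 bP] := shift_dist_cvg0 u x01 d0.
    have /andP[_ x1] := x01.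
    apply: filterS (near_h _ b0) => n hb; have /andP[_ fx] := fE n x x1.
    by apply: (le_trans fx); apply: bP; rewrite h0 hb.
  - move=> a /andP[a0 a1]; have a20 : 0 < a / 2 by rewrite divr_gt0.
    have a201 : 0 < a / 2 <= 1 by lra.
    have := lp_cut_normy u; have := lp_ge0 p `[0%R, 1%R] (cut_norm u).
    case E: (lp _ _ _) => [M| |]// _ _.
    have aM : (cut_norm u (a / 2) <= (M / (a / 2) `^ p^-1)%:E)%E.
      by apply: (cut_norm_le p1) => //; [exact: FB_normal|rewrite E].
    exists (M / (a / 2) `^ p^-1 + M / (a / 2) `^ p^-1).
    apply: filterS (near_h _ a20) => n hn x /andP[ax x1].
    have /andP[_ fx] := fE n x x1; apply: (le_trans fx).
    apply: (le_trans (shift_dist_le_norm u (h0 n) x1)); rewrite EFinD.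
    have hn0 := h0 n.
    by apply: leeD; apply: le_trans aM; (apply: cut_norm_antitone; [exact: FB_normal|lra|lra]).
  - move=> d d0; have d20 : 0 < d / 2 by rewrite divr_gt0.
    have [a a01 aP] := lp_near0 p1 (measurable_cut_norm u) (lp_cut_normy u) d20.
    have /andP[a0 a1] := a01; exists a => //; apply: nearW => n.
    rewrite lpf ?(ltW a0)//; apply: (le_trans (lp_shift_dist_le u (h0 n) a1)).
    by rewrite (splitr d) EFinD; exact: leeD.
move=> [N _ /(_ N (leqnn _)) /=]; rewrite lpf//.
by have [_] := hP N.
Qed.

(** The path from [[v]_a] through [[u]_a] and [[u]_(a - h)] to [[v]_(a - h)]: each outer leg costs
    at most [dp p u v], the last one after a translation by [h]. *)
Lemma lp_shift_dist_near u v h : 0 <= h ->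
  (lp p `[h, 1%R] (shift_dist v h) <=
   lp p `[h, 1%R] (shift_dist u h) + (dp p u v + dp p u v))%E.
Proof.
move=> h0.
have mh : measurable (`[h, 1%R] : set R) by [].
have nonempty (w : FB m p) a : a <= 1 -> alpha_cut w a !=set0.
  by move=> a1; apply: cut_nonempty => //; exact: (FB_normal w).
have m1 := measurable_cut_dist v u.
have m2 := measurable_shift h (measurable_cut_dist u v).
have m3 : measurable_fun setT
    (fun a => hausdorff_dist (alpha_cut u a) (alpha_cut v (a - h))).
  have shift_anti a b : a <= b -> alpha_cut v (b - h) `<=` alpha_cut v (a - h).
    by move=> ab; apply: alpha_cut_antitone; rewrite lerD2r.
  exact (measurable_hausdorff_dist (@alpha_cut_antitone R m u) shift_anti).
have b1 : (lp p `[h, 1%R] (cut_dist v u) <= dp p u v)%E.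
  rewrite dpC; apply: (lp_subset p1) => // x /=.
  by rewrite !in_itv/= => /andP[/(le_trans h0) -> ->].
have b2 : (lp p `[h, 1%R] (fun x => cut_dist u v (x - h)) <= dp p u v)%E.
  rewrite lp_itv_shift ?subrr; last exact: measurable_cut_dist.
  apply: (lp_subset p1) => //; first exact: measurable_cut_dist.
  move=> x /=; rewrite !in_itv/= => /andP[-> /le_trans -> //].
  by rewrite gerBl.
have c1 : (lp p `[h, 1%R] (fun a => hausdorff_dist (alpha_cut u a) (alpha_cut v (a - h))) <=
    lp p `[h, 1%R] (shift_dist u h) + lp p `[h, 1%R] (fun x => cut_dist u v (x - h)))%E.
  apply: (lp_minkowski p1 mh (measurable_shift_dist u h) m2 m3) => //= x;
    rewrite in_itv/= => /andP[_ x1].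
  - exact: shift_dist_ge0.
  - by apply: hausdorff_dist_ge0; apply: nonempty; exact: le1B.
  - rewrite hausdorff_dist_ge0/=; last exact: nonempty.
    by apply: hausdorff_dist_triangle; apply: nonempty => //; exact: le1B.
have c2 : (lp p `[h, 1%R] (shift_dist v h) <= lp p `[h, 1%R] (cut_dist v u) +
    lp p `[h, 1%R] (fun a => hausdorff_dist (alpha_cut u a) (alpha_cut v (a - h))))%E.
  apply: (lp_minkowski p1 mh m1 m3 (measurable_shift_dist v h)) => /= x;
    rewrite in_itv/= => /andP[_ x1].
  - by apply: hausdorff_dist_ge0; exact: nonempty.
  - by apply: hausdorff_dist_ge0; exact: nonempty.
  - rewrite shift_dist_ge0//=.
    by apply: hausdorff_dist_triangle; apply: nonempty => //; exact: le1B.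
apply: (le_trans c2); apply: (le_trans (leeD b1 c1)).
by rewrite addeCA; exact: (leeD (lexx _) (leeD (lexx _) b2)).
Qed.

End shift.

(** * Necessity and sufficiency of the two conditions *)

Section characterization.
Context (R : realType) (m : nat) (p : R).
Hypothesis p1 : 1 <= p.
Implicit Types (U : set (FB m p)) (u v : FB m p).

Let p0 : 0 < p. Proof. exact: lt_le_trans p1. Qed.

(** Near each [u] the norm of [u] plus 1 is a bound; compactness of the closure gives a common
    one. *)
Lemma compact_pmean_bounded U : compact (closure U) -> uniformly_pmean_bounded U.
Proof.
move=> /compact_near_coveringP/(_ R (pinfty_nbhs R)
  (fun M u => lp p `[0%R, 1%R] (cut_norm u) <= M%:E)%E _)[].
  move=> u _; exists ([set v : FB m p | dp p u v < 1%:E]%E,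
      [set M : R | fine (lp p `[0%R, 1%R] (cut_norm u)) + 1 < M]) => /=.
    split; first by apply/(nbhs_dpP p1); exists 1.
    by apply: nbhs_pinfty_gt; exact: num_real.
  move=> [v M] /= [uv uM]; apply: (le_trans (lp_cut_norm_le_dp p1 v u _ _)) => //.
  have uE : lp p `[0%R, 1%R] (cut_norm u) \is a fin_num.
    by rewrite ge0_fin_numE ?lp_cut_normy//; exact: lp_ge0.
  rewrite -(fineK uE) dpC; apply: le_trans (leeD (lexx _) (ltW uv)) _.
  by rewrite -EFinD lee_fin ltW.
move=> M [_ /(_ (Num.max M 0 + 1)) MP]; exists (Num.max M 0 + 1).
  by rewrite ltr_wpDl// le_max lexx orbT.
move=> u Uu; rewrite dp_fuzzy0; apply: MP; last exact: subset_closure.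
by rewrite ltr_pwDr// le_max lexx.
Qed.

Lemma compact_pmean_equi_left_continuous U :
  compact (closure U) -> pmean_equi_left_continuous U.
Proof.
move=> cU e e0; have e40 : 0 < e / 4 by rewrite divr_gt0.
have /compact_near_coveringP/(_ R (nbhs (0 : R))
  (fun h u => 0 <= h -> (lp p `[h, 1%R] (shift_dist u h) < e%:E)%E) _) := cU.
case.
  move=> u _; have [d d0 dP] := FB_pmean_left_continuous p1 u e40.
  exists ([set v : FB m p | dp p u v < (e / 4)%:E]%E, [set h : R | h < d]) => /=.
    split; first by apply/(nbhs_dpP p1); exists (e / 4).
    exact: lt_nbhsl.
  move=> [v h] /= [uv hd] h0.
  apply: (le_lt_trans (lp_shift_dist_near p1 u v h0)).
  apply: (@le_lt_trans _ _ ((e / 4)%:E + ((e / 4)%:E + (e / 4)%:E))%E).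
    by apply: leeD; [apply: dP; rewrite h0|apply: leeD; exact: ltW].
  by rewrite -!EFinD lte_fin; lra.
move=> d /= d0 dP; exists d => // h u /andP[h0 hd] Uu.
apply: (dP h) => //; last exact: subset_closure.
by rewrite /ball/= sub0r normrN ger0_norm.
Qed.

Lemma pmean_bounded_norm U : uniformly_pmean_bounded U ->
  exists M : R, forall u, closure U u -> (lp p `[0%R, 1%R] (cut_norm u) <= M%:E)%E.
Proof.
move=> [M M0 UM]; exists (M + 1) => u /(closure_dpP p1)/(_ _ ltr01)[v Uv uv].
apply: (le_trans (lp_cut_norm_le_dp p1 u v _ _)) => //.
rewrite EFinD; apply: leeD; last exact: ltW.
by rewrite -dp_fuzzy0; exact: UM.
Qed.

(* A point at height [a] is compared with the cut at height [a + h], whose norm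
   is controlled by (i). *)
Lemma pmean_near0 U : uniformly_pmean_bounded U -> pmean_equi_left_continuous U ->
  forall e : R, 0 < e -> exists2 a : R, 0 < a <= 1 &
    forall u, U u -> (lp p `[0%R, a] (cut_norm u) <= e%:E)%E.
Proof.
move=> /pmean_bounded_norm[M UM] equi e e0.
have e20 : 0 < e / 2 by rewrite divr_gt0.
have [d d0 dP] := equi _ e20.
(* [h < d] makes (ii) applicable, and [h] and [a] are both at most 1/2 so that the levels [x + h]
   stay in [[0, 1]]. *)
pose h := Num.min (d / 2) 2^-1.
have h0 : 0 < h by rewrite lt_min divr_gt0//= invr_gt0.
have hd : h < d by rewrite gt_min; apply/orP; left; lra.
have h12 : h <= 2^-1 by rewrite ge_min lexx orbT.
have h01 : 0 < h <= 1 by rewrite h0 (le_trans h12)// invf_le1// ler1n.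
pose K := Num.max (M / h `^ p^-1) 0 + 1.
have K0 : 0 < K by rewrite ltr_wpDl// le_max lexx orbT.
pose a := Num.min 2^-1 ((e / 2 / K) `^ p).
have a0 : 0 < a by rewrite lt_min invr_gt0 ltr0n/= powR_gt0 ?divr_gt0.
have a12 : a <= 2^-1 by rewrite ge_min lexx.
have a1 : a <= 1 by rewrite (le_trans a12)// invf_le1// ler1n.
exists a; first by rewrite a0.
move=> u Uu; have u1 := FB_normal u.
have ah x : x <= a -> x + h <= 1.
  by move=> xa; rewrite (splitr 1) !div1r; apply: lerD => //; exact: le_trans a12.
pose g (x : R) := hausdorff_dist (alpha_cut u (x + h)) (alpha_cut u x).
have mg : measurable_fun setT g.
  have shift_anti b c : b <= c -> alpha_cut u (c + h) `<=` alpha_cut u (b + h).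
    by move=> bc; apply: alpha_cut_antitone; rewrite lerD2r.
  exact (measurable_hausdorff_dist shift_anti (@alpha_cut_antitone R m u)).
have mN : measurable_fun setT (fun x : R => cut_norm u (x + h)).
  by have := measurable_shift (- h) (measurable_cut_norm u); under eq_fun do rewrite opprK.
have nonempty x : x <= 1 -> alpha_cut u x !=set0 by move=> x1; exact: cut_nonempty.
apply: (@le_trans _ _ (lp p `[0%R, a] g + lp p `[0%R, a] (fun x => cut_norm u (x + h)))%E).
  apply: (lp_minkowski p1 _ mg mN (measurable_cut_norm u)) => //= x;
    rewrite in_itv/= => /andP[x0 xa].
  - by apply: hausdorff_dist_ge0; apply: nonempty; exact: ah.
  - by apply: cut_norm_ge0 => //; exact: ah.
  - rewrite cut_norm_ge0//=; last exact: le_trans a1.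
    rewrite /g hausdorff_distC; apply: hausdorff_dist_triangle; last by exists 0.
      by apply: nonempty; exact: le_trans a1.
    by apply: nonempty; exact: ah.
rewrite (splitr e) EFinD; apply: leeD.
  have -> : lp p `[0%R, a] g = lp p `[h, (a + h)] (shift_dist u h).
    have := lp_itv_shift p h (a + h) h mg; rewrite subrr addrK => <-.
    by apply: eq_lp => x _; rewrite /g /shift_dist subrK.
  apply: (@le_trans _ _ (lp p `[h, 1%R] (shift_dist u h))); last first.
    by apply: ltW; apply: dP => //; rewrite (ltW h0).
  apply: (lp_subset p1) => //; first exact: measurable_shift_dist.
  move=> x /=; rewrite !in_itv/= => /andP[-> /le_trans -> //]; exact: ah.
apply: (@le_trans _ _ (lp p `[0%R, a] (cst K%:E))).
  apply: (lp_le p1) => // x; rewrite /= in_itv/= => /andP[x0 xa].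
  rewrite cut_norm_ge0 ?ah//=; apply: (@le_trans _ _ (cut_norm u h)).
    by apply: cut_norm_antitone; rewrite ?lerDr ?ah.
  apply: (le_trans (cut_norm_le p1 u1 h01 (UM _ (subset_closure Uu)))).
  by rewrite lee_fin /K -[leLHS]addr0; apply: lerD; rewrite ?le_max ?lexx.
rewrite (lp_cst_itv p1) ?(ltW K0)// lee_fin mulrC -ler_pdivlMr//.
have eK0 : 0 <= e / 2 / K by rewrite divr_ge0 ?ltW.
apply: (@le_trans _ _ (((e / 2 / K) `^ p) `^ p^-1)).
  apply: ge0_ler_powR; rewrite ?nnegrE ?powR_ge0 ?(ltW a0)//.
    by rewrite invr_ge0 ltW.
  by rewrite ge_min lexx orbT.
by rewrite -powRrM mulfV ?gt_eqF// powRr1.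
Qed.

(** The bound at a positive level comes from (i) by [cut_norm_le]. The smallness near 0, known on
    [U], reaches the closure by approximation within [e / 2]. *)
Lemma pmean_tight U : uniformly_pmean_bounded U -> pmean_equi_left_continuous U ->
  cut_tight (closure U).
Proof.
move=> bU eU; split=> [a a01|e e0].
  have [M UM] := pmean_bounded_norm bU; exists (M / a `^ p^-1) => u clu.
  by apply: (cut_norm_le p1 (FB_normal u) a01); exact: UM.
have e20 : 0 < e / 2 by rewrite divr_gt0.
have [a a01 aP] := pmean_near0 bU eU e20; exists a => //.
have /andP[a0 a1] := a01.
move=> u /(closure_dpP p1)/(_ _ e20)[v Uv uv].
apply: (le_trans (lp_cut_norm_le_dp p1 u v _ _)) => //.
  by move=> x /=; rewrite !in_itv/= => /andP[-> /le_trans ->].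
by rewrite (splitr e) EFinD; apply: leeD; [exact: aP|exact: ltW].
Qed.

End characterization.

Theorem theorem4p1 (R : realType) (m : nat) (p : R) (U : set (FB m p)) :
  (0 < m)%N -> 1 <= p ->
  relatively_compact U <->
  uniformly_pmean_bounded U /\ pmean_equi_left_continuous U.
Proof.
move=> _ p1; split=> [cU|[bU eU]].
  by split; [exact: compact_pmean_bounded|exact: compact_pmean_equi_left_continuous].
apply: (tight_closed_compact p1); last exact: closed_closure.
exact: pmean_tight.
Qed.
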